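(* Let $R$ be an associative ring with unity and let $n\ge 3$ be an integer. Then $$(\mathrm K_{2,n}(R))_2 \xrightarrow{\delta} \mathrm K_{2,n}(R) \xrightarrow{\eta} \pi_1(\mathrm{EUm}_n(R)) \xrightarrow{\mu} \mathrm K_{1,n-1}(R)/(\mathrm K_{1,n-1}(R))_2 \xrightarrow{\lambda} \mathrm K_{1,n}(R) \xrightarrow{\alpha} \pi_0(\mathrm{Um}_n(R)) \xrightarrow{\beta} \mathrm K^s_{0,n-1}(R) \xrightarrow{\gamma} \mathrm K^s_{0,n}(R)$$ is an exact sequence of pointed sets.
   Context: **Groups.** $E_{ij}(r)=I_n+re_{ij}$ ($i\ne j$, $r\in R$); $\mathrm{E}_n(R)\subseteq\mathrm{GL}_n(R)$ is generated by these. $\mathrm{St}_n(R)$ is the Steinberg group with generators $X_{ij}(r)$ ($i\neq j$) and relations $X_{ij}(r)X_{ij}(s)=X_{ij}(r+s)$, $[X_{ij}(r),X_{kl}(s)]=1$ if $j\ne k,i\neq l$, $[X_{ij}(r),X_{jl}(s)]=X_{il}(rs)$ if $i\ne l$; $\theta_n:\mathrm{St}_n(R)\to\mathrm{GL}_n(R)$ sends $X_{ij}(r)$ to $E_{ij}(r)$. $J_n=\{(i,j):1\le i,j\le n,i\neq j\}$; $\alpha\subseteq J_n$ is nilpotent if $(i,j)\in\alpha\Rightarrow(j,i)\notin\alpha$ and $(i,j),(j,k)\in\alpha\Rightarrow(i,k)\in\alpha$; $\Phi_n$ is the set of nilpotent subsets. $\mathrm{E}_n(R)_\alpha$ (resp.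 $\mathrm{St}_n(R)_\alpha$) is the subgroup generated by the $E_{ij}(r)$ (resp. $X_{ij}(r)$) with $(i,j)\in\alpha$. Put $e=(1,0,\ldots,0)$, $\mathrm{P}_n(R)=\{\sigma\in\mathrm{GL}_n(R):e\sigma=e\}$, $\mathrm{EP}_n(R)=\mathrm P_n(R)\cap\mathrm E_n(R)$, $\widetilde{P_n}(R)=\theta_n^{-1}(\mathrm{EP}_n(R))$. $(\mathrm{EP}_n(R))_2$ is the subgroup generated by all elements of $\mathrm{EP}_n(R)$ of the form $x^{-1}\varepsilon_\alpha\varepsilon_\beta x$ with $x\in\mathrm E_n(R)$, $\varepsilon_\alpha\in\mathrm E_n(R)_\alpha$, $\varepsilon_\beta\in \mathrm E_n(R)_\beta$, $\alpha,\beta\in\Phi_n$; $(\widetilde{P_n}(R))_2\subseteq\widetilde{P_n}(R)$ is defined analogously with $\mathrm{St}_n$ in place of $\mathrm E_n$. **K-objects.** $\mathrm K_{2,n}(R)=\ker\theta_n$; $(\mathrm K_{2,n}(R))_2=\mathrm K_{2,n}(R)\cap(\widetilde{P_n}(R))_2$. $\mathrm K_{1,m}(R)=\mathrm{GL}_m(R)/\mathrm E_m(R)$ (cosets $\sigma\mathrm E_m(R)$, base point $[I_m]$). $\mathrm{GL}_{n-1}(R)$ is embedded in $\mathrm{GL}_n(R)$ by $\tau\mapsto\begin{pmatrix}1&0\\0&\tau\end{pmatrix}$; $(\mathrm K_{1,n-1}(R))_2=(\mathrm{GL}_{n-1}(R)\cap(\mathrm{EP}_n(R))_2)/\mathrm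 E_{n-1}(R)$, and $\mathrm K_{1,n-1}(R)/(\mathrm K_{1,n-1}(R))_2$ is the set of cosets $\tau\,(\mathrm{GL}_{n-1}(R)\cap(\mathrm{EP}_n(R))_2)$, $\tau\in\mathrm{GL}_{n-1}(R)$, with base point the class of $I_{n-1}$. $\mathrm K^s_{0,m}(R)$ is the set of isomorphism classes of finitely generated projective modules $P$ such that $P\oplus R^r\simeq R^{m+r}$ for some $r$ (depending on $P$), with base point $[R^m]$. **Homotopy objects.** $\mathrm{Um}_n(R)$ is the set of rows $v\in R^n$ with $\sum_iv_iw_i=1$ for some $w\in R^n$, and $\mathrm{EUm}_n(R)=e\mathrm E_n(R)$. Both are global actions with local groups $\mathrm E_n(R)_\alpha$, $\alpha\in\Phi_n$, acting on the whole set by right multiplication. A local frame is a nonempty finite subset contained in a single orbit of a single local group. A path is a map $\omega$ from $\mathbb Z$ to the underlying set with each $\{\omega(m),\omega(m+1)\}$ a local frame, constant for $m\ll0$ (initial point) and for $m\gg0$ (terminal point). $\pi_0$ is the set of classes of points joined by paths (for $\mathrm{Um}_n(R)$ this is $\mathrm{Um}_n(R)/\mathrm E_n(R)$), with base point the class $[e]$. Two paths $\omega,\omega'$ are stably homotopic if there is a map $H$ on $\mathbb Z\times\mathbb Z$ sending each unit square $\{m,m+1\}\times\{k,k+1\}$ to a local frame, with each $H(\cdot,k)$ a path whose initial and terminal points do not depend on $k$, and $H(\cdot,k)=\omega$ for $k\ll 0$, $=\omega'$ for $k\gg0$. $\pi_1(\mathrm{EUm}_n(R))$ is the group of stable homotopy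 classes of loops at $e$ under concatenation. It is identified with $\widetilde{P_n}(R)/(\widetilde{P_n}(R))_2$ by path lifting: a loop $e,eg_1,eg_1g_2,\ldots,eg_1\cdots g_N=e$ with $g_i\in\mathrm E_n(R)_{\alpha_i}$ corresponds to the class of $x_1\cdots x_N$, where $x_i\in\mathrm{St}_n(R)_{\alpha_i}$ is the unique element with $\theta_n(x_i)=g_i$. **Maps.** $\delta$ is the inclusion; $\eta(Y)=Y(\widetilde{P_n}(R))_2$; $\mu(Y(\widetilde{P_n}(R))_2)=[\theta_n(Y)_{rd}](\mathrm K_{1,n-1}(R))_2$, where $\sigma_{rd}=\tau$ for $\sigma=\begin{pmatrix}1&0\\ v&\tau\end{pmatrix}\in\mathrm{EP}_n(R)$; $\lambda$ sends the class of $\tau$ to $\begin{pmatrix}1&0\\0&\tau\end{pmatrix}\mathrm E_n(R)$; $\alpha(\sigma\mathrm{E}_n(R))=(e\sigma)\mathrm E_n(R)$; $\beta([v])=[\ker\beta_v]$, where $\beta_v:R^n\to R$, $\beta_v(w)=\sum_iv_iw_i$ (a map of right $R$-modules; projective modules here are right modules); $\gamma([P])=[P\oplus R]$. *)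

(* Defs.v *)
From HB Require Import structures.
From mathcomp Require Import all_boot all_order all_algebra.
From mathcomp Require Import zify.
From mathcomp Require Import boolp classical_sets functions cardinality.

Set Implicit Arguments.
Unset Strict Implicit.
Unset Printing Implicit Defensive.

Import GRing.Theory.
Local Open Scope classical_set_scope.
Local Open Scope ring_scope.

(* Sets of equivalence classes of a relation R on a subset D, as sets of      *)
(* subsets. Bare predicates are used instead of classical_sets.set, whose     *)
(* universe is too small for classes of modules.                              *)

Record quotient (T : Type) (D : T -> Prop) (R : T -> T -> Prop) := Quotient {
  qclass :> T -> Prop;
  qclassP : exists2 x, D x & qclass = (fun y => D y /\ R x y)
}.

Definition cls T (D : T -> Prop) (R : T -> T -> Prop) (x : T) (Dx : D x) :
    quotient D R :=
  @Quotient T D R (fun y => D y /\ R x y) (ex_intro2 _ _ x Dx erefl).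

Lemma quotient_inj T (D : T -> Prop) R (C C' : quotient D R) :
  (forall x, C x <-> C' x) -> C = C'.
Proof.
case: C C' => [A pA] [B pB] /= AB.
have {}AB : A = B by apply/funext => x; apply/propext.
by case: B / AB pB => pB; congr Quotient; exact: Prop_irrelevance.
Qed.

Definition equiv_on T (D : T -> Prop) (R : T -> T -> Prop) :=
  [/\ forall x, D x -> R x x,
      forall x y, D x -> D y -> R x y -> R y x &
      forall x y z, D x -> D y -> D z -> R x y -> R y z -> R x z].

Lemma cls_eq T (D : T -> Prop) R x y (Dx : D x) (Dy : D y) :
  equiv_on D R -> R x y -> cls R Dx = cls R Dy.
Proof.
move=> [_ symR trR] Rxy; apply: quotient_inj => z /=.
by split=> -[Dz Rz]; split=> //; [apply: (trR y x z) | apply: (trR x y z)];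
  rewrite //; apply: symR.
Qed.

Section QuotientMap.
Variables (T T' : Type) (D : T -> Prop) (D' : T' -> Prop).
Variables (R : T -> T -> Prop) (R' : T' -> T' -> Prop).
Hypotheses (eqR : equiv_on D R) (eqR' : equiv_on D' R').
Variable f : T -> T'.
Hypothesis fD : forall x, D x -> D' (f x).
Hypothesis fR : forall x y, D x -> D y -> R x y -> R' (f x) (f y).

Fact image_class x y : D x ->
  (D' y /\ exists2 z, D z /\ R x z & R' (f z) y) <-> (D' y /\ R' (f x) y).
Proof.
case: eqR eqR' => [rR _ _] [_ _ tR'] Dx; split=> -[D'y].
  case=> z [Dz Rxz] Rzy; split=> //.
  by apply: (tR' _ (f z)); [apply: fD|apply: fD|rewrite //|apply: fR|].
by move=> Rfy; split=> //; exists x => //; split=> //; apply: rR.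
Qed.

Fact quotient_map_subproof (C : quotient D R) :
  exists2 x', D' x' & (fun y => D' y /\ exists2 x, qclass C x & R' (f x) y)
                        = (fun y => D' y /\ R' x' y).
Proof.
case: C => C /= [x Dx ->]; exists (f x); first exact: fD.
by apply/funext => y; apply/propext/image_class.
Qed.

(* the map [x] |-> [f x] *)
Definition quotient_map (C : quotient D R) : quotient D' R' :=
  Quotient (quotient_map_subproof C).

Lemma quotient_map_cls x (Dx : D x) :
  quotient_map (cls R Dx) = cls R' (fD Dx).
Proof. by apply: quotient_inj => y; apply: image_class. Qed.

End QuotientMap.

Record pointedSet := PointedSet { pcarrier :> Type; base : pcarrier }.
Arguments base : clear implicits.

Definition pointed_map (A B : pointedSet) (f : A -> B) := f (base A) = base B.

(* the image of f is the kernel of g *)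
Definition exact_at (A B C : pointedSet) (f : A -> B) (g : B -> C) :=
  forall y, (exists x, f x = y) <-> g y = base C.

Section Groups.
Local Open Scope group_scope.
Variable G : groupType.
Implicit Types (x y : G) (A H K : set G).

(* G may be infinite, so fingroup's {group gT} does not apply *)
Definition is_subgroup H :=
  [/\ H 1, forall x y, H x -> H y -> H (x * y) & forall x, H x -> H x^-1].

Definition generated A : set G := smallest is_subgroup A.

Definition same_lcoset H x y := H (x^-1 * y).

Definition cosets K H := quotient K (same_lcoset H).

Lemma generated_subgroup A : is_subgroup (generated A).
Proof.
split=> [H [[]] //|x y Hx Hy H [sH AH]|x Hx H [sH AH]].
  by case: (sH) => _ M _; apply: M; [apply: Hx|apply: Hy].
by case: (sH) => _ _ V; apply: V; apply: Hx.
Qed.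

Lemma generated_sub A : A `<=` generated A.
Proof. exact: sub_gen_smallest. Qed.

Lemma same_lcoset_equiv K H : is_subgroup H -> equiv_on K (same_lcoset H).
Proof.
move=> [H1 HM HV]; split=> [x _|x y _ _|x y z _ _ _]; rewrite /same_lcoset.
- by rewrite mulVg.
- by move=> /HV; rewrite invgM invgK.
- by move=> xy yz; have := HM _ _ xy yz; rewrite mulgA mulgK.
Qed.

End Groups.

Lemma generated_morph (G G' : groupType) (f : G -> G') (A : set G) (H : set G') :
  {morph f : x y / (x * y)%g} -> is_subgroup H ->
  A `<=` f @^-1` H -> generated A `<=` f @^-1` H.
Proof.
move=> fM [H1 HM HV] AH.
have f1 : f 1%g = 1%g by apply: (@mulgI _ (f 1%g)); rewrite -fM !mulg1.
have fV x : f x^-1%g = (f x)^-1%g.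
  by apply: (@mulgI _ (f x)); rewrite -fM !mulgV.
apply: smallest_sub => //; split=> /= [|x y Hx Hy|x Hx].
- by rewrite f1.
- by rewrite fM; apply: HM.
- by rewrite fV; apply: HV.
Qed.

(* GL_n(R) for a possibly noncommutative (and possibly zero) ring: a matrix   *)
(* together with its two-sided inverse, which it determines.                  *)

Section GeneralLinear.
Variables (R : pzRingType) (n : nat).

Record GL := MkGL {
  gl_pair : 'M[R]_n * 'M[R]_n;
  _ : (gl_pair.1 *m gl_pair.2 == 1%:M) && (gl_pair.2 *m gl_pair.1 == 1%:M)
}.

HB.instance Definition _ := [isSub for gl_pair].
HB.instance Definition _ := [Choice of GL by <:].

Definition gl_mx (s : GL) : 'M[R]_n := (gl_pair s).1.

Lemma gl_mulV (s : GL) : gl_mx s *m (gl_pair s).2 = 1%:M.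
Proof. by have /andP[/eqP] := valP s. Qed.
Lemma gl_Vmul (s : GL) : (gl_pair s).2 *m gl_mx s = 1%:M.
Proof. by have /andP[_ /eqP] := valP s. Qed.

Lemma gl_inj : injective gl_mx.
Proof.
move=> s t st; apply: val_inj => /=.
rewrite [LHS]surjective_pairing [RHS]surjective_pairing.
rewrite -/(gl_mx s) -/(gl_mx t) st; congr pair.
by rewrite -[LHS]mulmx1 -(gl_mulV t) -st mulmxA gl_Vmul mul1mx.
Qed.

Fact gl_one_subproof :
  (1%:M *m 1%:M == 1%:M :> 'M[R]_n) && (1%:M *m 1%:M == 1%:M :> 'M[R]_n).
Proof. by rewrite mulmx1 eqxx. Qed.
Definition gl_one := @MkGL (1%:M, 1%:M) gl_one_subproof.

Fact gl_inv_subproof (s : GL) :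
  ((gl_pair s).2 *m (gl_pair s).1 == 1%:M)
    && ((gl_pair s).1 *m (gl_pair s).2 == 1%:M).
Proof. by rewrite andbC; exact: valP s. Qed.
Definition gl_inv (s : GL) :=
  @MkGL ((gl_pair s).2, (gl_pair s).1) (gl_inv_subproof s).

Fact gl_mul_subproof (s t : GL) (p := gl_pair s) (q := gl_pair t) :
  (p.1 *m q.1 *m (q.2 *m p.2) == 1%:M)
    && (q.2 *m p.2 *m (p.1 *m q.1) == 1%:M).
Proof.
have /andP[/eqP p1 /eqP p2] := valP s; have /andP[/eqP q1 /eqP q2] := valP t.
rewrite -[val s]/p -[val t]/q in p1 p2 q1 q2 *.
by rewrite !mulmxA -(mulmxA _ q.1) q1 -(mulmxA _ p.2) p2 !mulmx1 p1 q2 eqxx.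
Qed.
Definition gl_mul (s t : GL) :=
  @MkGL (gl_mx s *m gl_mx t, (gl_pair t).2 *m (gl_pair s).2)
        (gl_mul_subproof s t).

Fact gl_mulA : associative gl_mul.
Proof. by move=> s t u; apply: gl_inj; apply: mulmxA. Qed.
Fact gl_mul1 : left_id gl_one gl_mul.
Proof. by move=> s; apply: gl_inj; apply: mul1mx. Qed.
Fact gl_1mul : right_id gl_one gl_mul.
Proof. by move=> s; apply: gl_inj; apply: mulmx1. Qed.
Fact gl_mulVx : left_inverse gl_one gl_inv gl_mul.
Proof. by move=> s; apply: gl_inj; apply: gl_Vmul. Qed.
Fact gl_mulxV : right_inverse gl_one gl_inv gl_mul.
Proof. by move=> s; apply: gl_inj; apply: gl_mulV. Qed.

HB.instance Definition _ :=
  isGroup.Build GL gl_mulA gl_mul1 gl_1mul gl_mulVx gl_mulxV.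

Lemma gl_mxM (s t : GL) : gl_mx (s * t)%g = gl_mx s *m gl_mx t.
Proof. by []. Qed.
Lemma gl_mx1 : gl_mx 1%g = 1%:M.
Proof. by []. Qed.

End GeneralLinear.

Lemma mul_scaled_delta (R : pzRingType) n (i j k l : 'I_n) (r s : R) :
  (r *: delta_mx i j) *m (s *: delta_mx k l)
    = if j == k then (r * s) *: delta_mx i l else 0 :> 'M_n.
Proof.
rewrite -scalemxAl; apply/matrixP=> a b; rewrite !mxE (bigD1 j) //= big1.
  rewrite !mxE eqxx andbT addr0.
  case: (j =P k) => [_|_] /=; rewrite !mxE; last by rewrite !mulr0.
  by case: (a == i) (b == l) => [] []; rewrite ?(mulr0, mulr1, mul1r, mul0r).
by move=> c /negPf cj; rewrite !mxE cj andbF mul0r.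
Qed.

Section Steinberg.
Variables (R : pzRingType) (n : nat).
Implicit Types (i j k l : 'I_n) (r s : R).

Definition elem_mx i j r : 'M[R]_n := 1%:M + r *: delta_mx i j.

Fact elem_mxD i j r s : i != j ->
  elem_mx i j r *m elem_mx i j s = elem_mx i j (r + s).
Proof.
move=> ij; rewrite mulmxDl mul1mx mulmxDr mulmx1 mul_scaled_delta.
by rewrite /elem_mx eq_sym (negPf ij) addr0 scalerDl -addrA (addrC (s *: _)).
Qed.

Fact elem_mx0 i j : elem_mx i j 0 = 1%:M.
Proof. by rewrite /elem_mx scale0r addr0. Qed.

Fact elem_subproof i j (ij : i != j) r :
  (elem_mx i j r *m elem_mx i j (- r) == 1%:M)
    && (elem_mx i j (- r) *m elem_mx i j r == 1%:M).
Proof. by rewrite !elem_mxD // subrr addNr elem_mx0 eqxx. Qed.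

Definition elem i j (ij : i != j) r : GL R n :=
  @MkGL R n (elem_mx i j r, elem_mx i j (- r)) (elem_subproof ij r).

(* St_n(R): group words in the symbols X_ij(r), modulo the least congruence   *)
(* containing the group axioms and the Steinberg relations.                   *)

Inductive st_word : Type :=
| st_gen i j of i != j & R
| st_one
| st_mul of st_word & st_word
| st_inv of st_word.

HB.instance Definition _ := gen_eqMixin st_word.
HB.instance Definition _ := gen_choiceMixin st_word.

(* With the convention x^-1 y^-1 x y the relations below define the same group. *)
Definition st_comm (x y : st_word) :=
  st_mul (st_mul (st_mul x y) (st_inv x)) (st_inv y).

Inductive st_eq : st_word -> st_word -> Prop :=
| st_refl x : st_eq x x
| st_sym x y : st_eq x y -> st_eq y x
| st_trans x y z : st_eq x y -> st_eq y z -> st_eq x z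
| st_mul_congr x x' y y' :
    st_eq x x' -> st_eq y y' -> st_eq (st_mul x y) (st_mul x' y')
| st_inv_congr x x' : st_eq x x' -> st_eq (st_inv x) (st_inv x')
| st_mulA x y z : st_eq (st_mul x (st_mul y z)) (st_mul (st_mul x y) z)
| st_mul1 x : st_eq (st_mul st_one x) x
| st_1mul x : st_eq (st_mul x st_one) x
| st_mulVx x : st_eq (st_mul (st_inv x) x) st_one
| st_mulxV x : st_eq (st_mul x (st_inv x)) st_one
| st_relD i j (ij : i != j) r s :
    st_eq (st_mul (st_gen ij r) (st_gen ij s)) (st_gen ij (r + s))
| st_rel1 i j k l (ij : i != j) (kl : k != l) r s : j != k -> i != l ->
    st_eq (st_comm (st_gen ij r) (st_gen kl s)) st_one
| st_relM i j l (ij : i != j) (jl : j != l) (il : i != l) r s :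
    st_eq (st_comm (st_gen ij r) (st_gen jl s)) (st_gen il (r * s)).

Definition st_eqb : rel st_word := fun x y => `[< st_eq x y >].

Fact st_eqb_equiv : equiv_class_of st_eqb.
Proof.
split=> [x|x y|y x z]; rewrite /st_eqb.
- exact/asboolP/st_refl.
- by apply/asboolP/asboolP => /st_sym.
- by move=> /asboolP xy /asboolP yz; apply/asboolP; apply: st_trans xy yz.
Qed.

Canonical st_equiv := EquivRelPack st_eqb_equiv.

Local Open Scope quotient_scope.

Definition St := {eq_quot st_eqb}.
HB.instance Definition _ := Choice.on St.
HB.instance Definition _ := EqQuotient.on St.

Fact st_eqP x y : st_eq x y <-> \pi_St x = \pi_St y.
Proof.
by split=> [xy|/eqmodP/asboolP //]; apply/eqmodP/asboolP.
Qed.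

Fact st_reprP x : st_eq (repr (\pi_St x)) x.
Proof. by apply/st_eqP; rewrite reprK. Qed.

Definition St_one : St := \pi_St st_one.
Definition St_mul (x y : St) : St := \pi_St (st_mul (repr x) (repr y)).
Definition St_inv (x : St) : St := \pi_St (st_inv (repr x)).

Lemma St_mul_pi x y : St_mul (\pi_St x) (\pi_St y) = \pi_St (st_mul x y).
Proof. by apply/st_eqP; apply: st_mul_congr; apply: st_reprP. Qed.
Lemma St_inv_pi x : St_inv (\pi_St x) = \pi_St (st_inv x).
Proof. by apply/st_eqP/st_inv_congr/st_reprP. Qed.

Fact St_mulA : associative St_mul.
Proof.
elim/quotW=> x; elim/quotW=> y; elim/quotW=> z.
by rewrite (St_mul_pi y z) (St_mul_pi x y) !St_mul_pi; apply/st_eqP; apply: st_mulA.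
Qed.
Fact St_mul1 : left_id St_one St_mul.
Proof. by elim/quotW=> x; rewrite St_mul_pi; apply/st_eqP; apply: st_mul1. Qed.
Fact St_1mul : right_id St_one St_mul.
Proof. by elim/quotW=> x; rewrite St_mul_pi; apply/st_eqP; apply: st_1mul. Qed.
Fact St_mulVx : left_inverse St_one St_inv St_mul.
Proof.
by elim/quotW=> x; rewrite St_inv_pi St_mul_pi; apply/st_eqP; apply: st_mulVx.
Qed.
Fact St_mulxV : right_inverse St_one St_inv St_mul.
Proof.
by elim/quotW=> x; rewrite St_inv_pi St_mul_pi; apply/st_eqP; apply: st_mulxV.
Qed.

HB.instance Definition _ :=
  isGroup.Build St St_mulA St_mul1 St_1mul St_mulVx St_mulxV.

Definition stein i j (ij : i != j) r : St := \pi_St (st_gen ij r).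

Fixpoint st_eval (x : st_word) : GL R n :=
  match x with
  | st_gen i j ij r => elem ij r
  | st_one => 1%g
  | st_mul x y => (st_eval x * st_eval y)%g
  | st_inv x => (st_eval x)^-1%g
  end.

Definition theta (x : St) : GL R n := st_eval (repr x).

Fact elem_comm1 i j k l (ij : i != j) (kl : k != l) r s : j != k -> i != l ->
  (elem ij r * elem kl s = elem kl s * elem ij r)%g.
Proof.
move=> /negPf jk /negPf il; apply: gl_inj; rewrite !gl_mxM /gl_mx /= /elem_mx.
rewrite !(mulmxDl, mulmxDr, mul1mx, mulmx1) !mul_scaled_delta jk eq_sym il.
by rewrite !addr0 -!addrA; congr (_ + _); rewrite addrC.
Qed.

Fact elem_commM i j l (ij : i != j) (jl : j != l) (il : i != l) r s :
  (elem ij r * elem jl s = elem il (r * s)%R * elem jl s * elem ij r)%g.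
Proof.
apply: gl_inj; rewrite !gl_mxM /gl_mx /= /elem_mx.
do !rewrite ?(mulmxDl, mulmxDr, mul1mx, mulmx1, mul_scaled_delta, eqxx, mul0mx).
rewrite ![l == _]eq_sym (negPf il) (negPf jl) mul0mx !addr0.
by rewrite -[RHS]addrA (addrC (_ *: delta_mx i l)).
Qed.

Fact theta_st_eq x y : st_eq x y -> st_eval x = st_eval y.
Proof.
elim=> {x y} //=.
- by move=> x y z _ -> _ ->.
- by move=> x x' y y' _ -> _ ->.
- by move=> x x' _ ->.
- by move=> x y z; apply: mulgA.
- by move=> x; apply: mul1g.
- by move=> x; apply: mulg1.
- by move=> x; apply: mulVg.
- by move=> x; apply: mulgV.
- by move=> i j ij r s; apply: gl_inj; apply: elem_mxD.
- by move=> i j k l ij kl r s jk il; rewrite (elem_comm1 _ _ _ _ jk il) mulgK mulgV.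
- by move=> i j l ij jl il r s; rewrite (elem_commM _ _ il) !mulgK.
Qed.

Lemma theta_pi x : theta (\pi_St x) = st_eval x.
Proof. exact/theta_st_eq/st_reprP. Qed.

Lemma thetaM : {morph theta : x y / (x * y)%g}.
Proof.
elim/quotW=> x; elim/quotW=> y.
by rewrite [(_ * _)%g]St_mul_pi !theta_pi.
Qed.

Lemma theta_stein i j (ij : i != j) r : theta (stein ij r) = elem ij r.
Proof. exact: theta_pi. Qed.

End Steinberg.

Section ElementarySubgroups.
Variables (R : pzRingType) (n : nat).
Implicit Type al : {set 'I_n * 'I_n}.

Definition nilpotent al :=
  [/\ forall i j, (i, j) \in al -> i != j,
      forall i j, (i, j) \in al -> (j, i) \notin al &
      forall i j k, (i, j) \in al -> (j, k) \in al -> (i, k) \in al].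

Definition E : set (GL R n) :=
  generated [set x | exists i j (ij : i != j) r, x = elem ij r].

Definition E_loc al : set (GL R n) :=
  generated [set x | exists i j (ij : i != j) r,
                       (i, j) \in al /\ x = elem ij r].

Definition St_loc al : set (St R n) :=
  generated [set x | exists i j (ij : i != j) r,
                       (i, j) \in al /\ x = stein ij r].

(* The subgroup generated by the elements of D of the form x^-1 a b x, with x *)
(* in W and a, b in local subgroups L al, L be.                               *)
Definition second (G : groupType) (L : {set 'I_n * 'I_n} -> set G)
    (W D : set G) : set G :=
  generated [set y | D y /\ exists al be x a b,
    [/\ nilpotent al /\ nilpotent be, W x, L al a, L be b &
        y = (x^-1 * a * b * x)%g]].

Lemma E_subgroup : is_subgroup E. Proof. exact: generated_subgroup. Qed.

Lemma E_loc_sub al : E_loc al `<=` E.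
Proof.
apply: sub_smallest2r; first exact: generated_subgroup.
by move=> x [i [j [ij [r [_ ->]]]]]; exists i, j, ij, r.
Qed.

Lemma theta_St_loc al x : St_loc al x -> E_loc al (theta x).
Proof.
apply: (generated_morph (@thetaM R n) (generated_subgroup _)) => y /=.
move=> [i [j [ij [r [ijal ->]]]]]; apply: generated_sub => /=.
by exists i, j, ij, r; rewrite theta_stein.
Qed.

Lemma theta_E (x : St R n) : E (theta x).
Proof.
have [E1 EM EV] := E_subgroup.
elim/quotW: x => x; rewrite theta_pi; elim: x => //= [i j ij r|x Ex y Ey|x Ex].
- by apply: generated_sub; exists i, j, ij, r.
- exact: EM.
- exact: EV.
Qed.

End ElementarySubgroups.

Section Parabolic.
Variables (R : pzRingType) (m : nat).

Definition e_row : 'rV[R]_m.+1 := delta_mx 0 0.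

Definition P : set (GL R m.+1) := [set s | e_row *m gl_mx s = e_row].
Definition EP : set (GL R m.+1) := P `&` @E R m.+1.
Definition Pt : set (St R m.+1) := @theta R m.+1 @^-1` EP.

Definition EP2 : set (GL R m.+1) := second (@E_loc R m.+1) (@E R m.+1) EP.
Definition Pt2 : set (St R m.+1) := second (@St_loc R m.+1) setT Pt.

(* the lower right block of (1 0; v tau); the value 1 is used when the two    *)
(* blocks are not inverse to each other, which does not happen on P           *)
Definition rd (s : GL R m.+1) : GL R m :=
  insubd (1%g : GL R m) (@drsubmx R 1 m 1 m (gl_mx s),
                         @drsubmx R 1 m 1 m (gl_mx s^-1%g)).

Fact emb_subproof (t : GL R m) (A := gl_mx t) (B := gl_mx t^-1%g) :
  (lift0_mx A *m lift0_mx B == 1%:M) && (lift0_mx B *m lift0_mx A == 1%:M).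
Proof.
rewrite /lift0_mx !mulmx_block !mulmx0 !mul0mx !mulmx1 !addr0 !add0r.
by rewrite {}/A {}/B gl_mulV gl_Vmul -scalar_mx_block eqxx.
Qed.

(* GL_m(R) -> GL_(m+1)(R), tau |-> (1 0; 0 tau) *)
Definition emb (t : GL R m) : GL R m.+1 :=
  @MkGL R m.+1 (lift0_mx (gl_mx t), lift0_mx (gl_mx t^-1%g)) (emb_subproof t).

Definition GL_EP2 : set (GL R m) := [set t | EP2 (emb t)].

Lemma embM : {morph emb : s t / (s * t)%g}.
Proof.
move=> s t; apply: gl_inj; rewrite gl_mxM /gl_mx /= /lift0_mx.
rewrite [RHS](@mulmx_block R 1 m 1 m 1 m).
by rewrite !mulmx0 !mul0mx !mulmx1 !addr0 !add0r.
Qed.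

Lemma P_subgroup : is_subgroup P.
Proof.
split=> [|s t|s]; rewrite /P /= ?gl_mx1 ?mulmx1 //.
  by rewrite gl_mxM mulmxA => -> ->.
move=> es; rewrite -[in LHS]es -mulmxA -gl_mxM mulgV gl_mx1 mulmx1 //.
Qed.

Lemma subgroupI (G : groupType) (H K : set G) :
  is_subgroup H -> is_subgroup K -> is_subgroup (H `&` K).
Proof.
move=> [H1 HM HV] [K1 KM KV]; split=> [|x y [? ?] [? ?]|x [? ?]]; split; auto.
Qed.

Lemma EP_subgroup : is_subgroup EP.
Proof. by apply: subgroupI; [exact: P_subgroup | exact: E_subgroup]. Qed.

Lemma EP2_subgroup : is_subgroup EP2. Proof. exact: generated_subgroup. Qed.

Lemma EP2_sub : EP2 `<=` EP.
Proof. by apply: smallest_sub; [exact: EP_subgroup | move=> x []]. Qed.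

Lemma GL_EP2_subgroup : is_subgroup GL_EP2.
Proof.
have emb1 : emb 1%g = 1%g by apply: (@mulgI _ (emb 1%g)); rewrite -embM !mulg1.
have embV t : emb t^-1%g = (emb t)^-1%g.
  by apply: (@mulgI _ (emb t)); rewrite -embM !mulgV.
have [E1 EM EV] := EP2_subgroup.
split=> [|x y Ex Ey|x Ex]; rewrite /GL_EP2 /= ?emb1 ?embM ?embV //.
  exact: EM.
exact: EV.
Qed.

Lemma P_block (s : GL R m.+1) : P s ->
  gl_mx s = block_mx 1%:M 0 (@dlsubmx R 1 m 1 m (gl_mx s))
                            (@drsubmx R 1 m 1 m (gl_mx s)).
Proof.
have e_blk : e_row = row_mx 1%:M 0 :> 'rV_(1 + m).
  apply/rowP=> j; rewrite !mxE eqxx /=.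
  by case: splitP => k jk; rewrite mxE ?ord1 -val_eqE /= jk // ord1.
rewrite /P /= -[gl_mx s in LHS](@submxK R 1 m 1 m) e_blk.
rewrite (@mul_row_block R 1 1 m 1 m) !mul1mx !mul0mx !addr0 => ulr.
have [ul ur] := @eq_row_mx R 1 1 m _ _ _ _ ulr.
by rewrite -ul -ur submxK.
Qed.

Lemma rd_mx (s : GL R m.+1) : P s -> gl_mx (rd s) = @drsubmx R 1 m 1 m (gl_mx s).
Proof.
have dr (t u : GL R m.+1) : P t -> P u ->
    @drsubmx R 1 m 1 m (gl_mx t) *m @drsubmx R 1 m 1 m (gl_mx u)
    = @drsubmx R 1 m 1 m (gl_mx (t * u)%g).
  move=> /P_block tb /P_block ub; rewrite gl_mxM [in RHS]tb [in RHS]ub.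
  by rewrite (@mulmx_block R 1 m 1 m 1 m) block_mxKdr mulmx0 add0r.
have [P1 PM PV] := P_subgroup.
move=> Ps; rewrite /gl_mx /rd -[gl_pair _]/(val _) val_insubd /=.
by rewrite !dr ?mulgV ?mulVg; [|exact: PV|done|done|exact: PV];
  rewrite gl_mx1 (@scalar_mx_block R 1 m) block_mxKdr eqxx.
Qed.

Lemma rdM (s t : GL R m.+1) : P s -> P t -> rd (s * t)%g = (rd s * rd t)%g.
Proof.
have [_ PM _] := P_subgroup.
move=> Ps Pt; apply: gl_inj; rewrite gl_mxM !rd_mx //; last exact: PM.
rewrite gl_mxM (P_block Ps) (P_block Pt) (@mulmx_block R 1 m 1 m 1 m).
by rewrite !block_mxKdr mulmx0 add0r.
Qed.

Fact lower_subproof (w : 'cV[R]_m)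
    (L := fun w : 'cV[R]_m => block_mx 1%:M 0 w 1%:M : 'M_(1 + m)) :
  (L w *m L (- w) == 1%:M) && (L (- w) *m L w == 1%:M).
Proof.
rewrite {}/L !mulmx_block !mulmx0 !mul0mx !mulmx1 !mul1mx !addr0 !add0r.
by rewrite subrr addNr -scalar_mx_block eqxx.
Qed.

Let lower w : GL R m.+1 := @MkGL R m.+1 (_, _) (lower_subproof w).
Let al0 : {set 'I_m.+1 * 'I_m.+1} := [set ij | (ij.1 != 0) && (ij.2 == 0)]%SET.

Lemma al0_nilpotent : nilpotent al0.
Proof.
split=> i j => [|| k]; rewrite !inE /=.
- by move=> /andP[i0 /eqP ->].
- by move=> /andP[i0 /eqP ->]; rewrite eqxx.
- by move=> /andP[i0 /eqP ->]; rewrite eqxx.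
Qed.

Lemma lower_loc w : E_loc al0 (lower w).
Proof.
have [L1 LM LV] : is_subgroup (@E_loc R m.+1 al0) by exact: generated_subgroup.
rewrite (matrix_sum_delta w).
elim/big_ind: _ => [|u v Lu Lv|i _].
- suff -> : lower 0 = 1%g by [].
  by apply: gl_inj; rewrite gl_mx1 (@scalar_mx_block R 1 m).
- suff -> : lower (u + v) = (lower u * lower v)%g by apply: LM.
  apply: gl_inj; rewrite gl_mxM /gl_mx /= [RHS](@mulmx_block R 1 m 1 m 1 m).
  by rewrite !mulmx0 !mul0mx !mulmx1 !mul1mx !addr0 !add0r.
rewrite big_ord1; have i0 : lift 0 i != 0 :> 'I_m.+1 by [].
apply: generated_sub; exists (lift 0 i), 0, i0, (w i 0); rewrite !inE i0 eqxx.
split=> //; apply: gl_inj; rewrite /gl_mx /= /elem_mx.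
apply/matrixP=> a b; rewrite !mxE (@split1 m a).
case: (unliftP 0 a) => [a'|] -> /=; rewrite mxE (@split1 m b);
  case: (unliftP 0 b) => [b'|] -> /=; rewrite !mxE.
- by rewrite andbF mulr0 addr0 -[in RHS]val_eqE /= /bump !add1n eqSS.
- by rewrite !eqxx !andbT add0r.
- by rewrite /= mulr0 addr0.
- by rewrite /= mulr0 addr0.
Qed.

Lemma EP2_emb_rd (u : GL R m.+1) : EP2 u -> EP2 (emb (rd u)).
Proof.
move=> EP2u; have [_ EM _] := EP2_subgroup.
have [[Pu Eu] lowE] := (EP2_sub EP2u, fun w => E_loc_sub (lower_loc w)).
pose w := - @dlsubmx R 1 m 1 m (gl_mx u).
suff -> : emb (rd u) = (lower w * u)%g.
  apply: (EM) => //; apply: generated_sub; split.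
    split; last exact: lowE.
    rewrite /P /= -rowE; apply/rowP=> j; rewrite !mxE (@split1 m 0).
    rewrite unlift_none /= mxE (@split1 m j).
    by case: (unliftP 0 j) => [j'|] -> /=; rewrite !mxE.
  exists al0, al0, 1%g, (lower w), 1%g.
  have [E1 _ _] := @E_subgroup R m.+1.
  have [L1 _ _] : is_subgroup (@E_loc R m.+1 al0) by exact: generated_subgroup.
  split=> //; [by split; exact: al0_nilpotent | exact: lower_loc |].
  by rewrite invg1 mul1g !mulg1.
apply: gl_inj; rewrite gl_mxM (P_block Pu) [RHS](@mulmx_block R 1 m 1 m 1 m).
rewrite /gl_mx /= /lift0_mx -/(gl_mx (rd u)) rd_mx //.
by rewrite !mulmx0 !mul0mx !mulmx1 !mul1mx !addr0 !add0r addNr.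
Qed.

Lemma theta_Pt2 x : Pt2 x -> EP2 (theta x).
Proof.
apply: (generated_morph (@thetaM R m.+1) EP2_subgroup) => y /=.
move=> [Pty [al [be [x' [a [b [nil _ La Lb defy]]]]]]].
apply: generated_sub; split; first exact: Pty.
have thV z : theta z^-1%g = (theta z)^-1%g :> GL R m.+1.
  apply: (@mulgI _ (theta z)); rewrite -thetaM !mulgV.
  by apply: (@mulgI _ (theta 1%g)); rewrite -thetaM !mulg1.
exists al, be, (theta x'), (theta a), (theta b); split=> //.
- exact: theta_E.
- exact: theta_St_loc.
- exact: theta_St_loc.
- by rewrite defy !thetaM thV.
Qed.

Lemma rd_theta_coset x y : Pt x -> Pt y -> same_lcoset Pt2 x y ->
  same_lcoset GL_EP2 (rd (theta x)) (rd (theta y)).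
Proof.
move=> [Px _] [Py _] /theta_Pt2 /EP2_emb_rd.
have rd_xy : rd (theta y) = (rd (theta x) * rd (theta (x^-1 * y)))%g.
  have [_ PM PV] := P_subgroup.
  have E1 : theta (x^-1 * y)%g = ((theta x)^-1 * theta y)%g.
    by apply: (@mulgI _ (theta x)); rewrite -thetaM !mulVKg.
  by rewrite -rdM ?E1 ?mulVKg //; apply: PM => //; apply: PV.
by rewrite /same_lcoset /GL_EP2 /= rd_xy mulKg.
Qed.

Lemma emb_coset s t : same_lcoset GL_EP2 s t ->
  same_lcoset (@E R m.+1) (emb s) (emb t).
Proof.
rewrite /same_lcoset => /EP2_sub[_].
have -> : emb (s^-1 * t)%g = ((emb s)^-1 * emb t)%g.
  by apply: (@mulgI _ (emb s)); rewrite -embM !mulVKg.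
by [].
Qed.

End Parabolic.

Section GlobalActions.
Variables (R : pzRingType) (n : nat).
Implicit Types (X F : set 'rV[R]_n) (v w : 'rV[R]_n) (om : int -> 'rV[R]_n).

Definition Um : set 'rV[R]_n :=
  [set v | exists w : 'cV[R]_n, \sum_i v 0 i * w i 0 = 1].

Definition local_frame X F :=
  [/\ F !=set0, finite_set F &
      exists al v, [/\ nilpotent al, X v &
                       F `<=` [set v *m gl_mx g | g in @E_loc R n al]]].

(* om is a path with initial point v and terminal point w *)
Definition is_path X om v w :=
  [/\ forall i, local_frame X [set om i; om (i + 1)],
      exists N, forall i, (i <= N)%R -> om i = v &
      exists N, forall i, (N <= i)%R -> om i = w].

Definition joined X v w := exists om, is_path X om v w.

Definition stably_homotopic X om om' := exists H : int -> int -> 'rV[R]_n,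
  [/\ forall i k, local_frame X
        [set H i k; H (i + 1) k; H i (k + 1); H (i + 1) (k + 1)],
      exists v w, forall k, is_path X (H ^~ k) v w,
      exists N, forall k, (k <= N)%R -> H ^~ k = om &
      exists N, forall k, (N <= k)%R -> H ^~ k = om'].

Definition pi0 X := quotient X (joined X).
Definition loops X v := [set om | is_path X om v v].
Definition pi1 X v := quotient (loops X v) (stably_homotopic X).

Lemma frame2 X v w al g : nilpotent al -> X v -> @E_loc R n al g ->
  w = v *m gl_mx g -> local_frame X [set v; w].
Proof.
move=> nil Xv Lg ->; split; first by exists v; left.
  by rewrite finite_setU; split; exact: finite_set1.
have [L1 _ _] : is_subgroup (@E_loc R n al) by exact: generated_subgroup.
exists al, v; split=> // x [->|->]; first by exists 1%g; rewrite ?gl_mx1 ?mulmx1.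
by exists g.
Qed.

Lemma nilpotent0 : nilpotent (finset.set0 : {set 'I_n * 'I_n}).
Proof. by split=> i j => [||k]; rewrite inE. Qed.

Lemma frame1 X v : X v -> local_frame X [set v; v].
Proof.
have [L1 _ _] : is_subgroup (@E_loc R n finset.set0) by exact: generated_subgroup.
by move=> Xv; apply: (frame2 nilpotent0 Xv L1); rewrite gl_mx1 mulmx1.
Qed.

Lemma const_path X v : X v -> is_path X (fun=> v) v v.
Proof. by split=> [i||]; [exact: frame1|exists 0|exists 0]. Qed.

Lemma joined_step X v w : X v -> X w -> local_frame X [set v; w] -> joined X v w.
Proof.
move=> Xv Xw Fvw; exists (fun i => if (i <= 0)%R then v else w).
split=> [i||]; last 2 first.
- by exists 0 => i ->.
- exists 1 => i i1; case: ifP => // i0.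
  by have := Order.POrderTheory.le_trans i1 i0.
case: ifP => i0; case: ifP => i1 //; try exact: frame1.
by move: i0 i1; case: i => [[|i]|[|i]].
Qed.

Lemma joined_sym X v w : joined X v w -> joined X w v.
Proof.
move=> [om [omF [N omN] [N' omN']]]; exists (fun i => om (- i)); split=> [i||].
- have := omF (- (i + 1)); rewrite opprD addrNK setUC.
  by rewrite -opprD.
- exists (- N') => i iN; apply: omN'; rewrite Num.Theory.lerNr //.
- exists (- N) => i iN; apply: omN; rewrite Num.Theory.lerNl //.
Qed.

Lemma joined_trans X u v w : joined X u v -> joined X v w -> joined X u w.
Proof.
move=> [om [omF [M omM] [N omN]]] [om' [om'F [M' omM'] [N' omN']]].
exists (fun i => if (i <= N)%R then om i else om' (i - N + M')); split=> [i||].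
- have [iN|Ni] := boolP (i + 1 <= N)%R.
    have -> : (i <= N)%R by lia.
    exact: omF.
  have [iN|iN] := boolP (i <= N)%R; last first.
    have -> : i + 1 - N + M' = i - N + M' + 1 by lia.
    exact: om'F.
  have -> : i = N by lia.
  rewrite (omN N) // -(omM' M') //.
  have -> : N + 1 - N + M' = M' + 1 by lia.
  exact: om'F.
- exists (Order.min M N) => i iMN.
  have -> : (i <= N)%R by lia.
  by apply: omM; lia.
- exists (Order.max (N + 1) (N' - M' + N)) => i iN.
  have -> : (i <= N)%R = false by lia.
  by apply: omN'; lia.
Qed.

Lemma joined_equiv X : equiv_on X (joined X).
Proof.
split=> [v Xv|v w _ _|u v w _ _ _]; last exact: joined_trans.
  by exists (fun=> v); exact: const_path.
exact: joined_sym.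
Qed.

Lemma Um_mul v (g : GL R n) : Um v -> Um (v *m gl_mx g).
Proof.
move=> [w vw]; exists (gl_mx g^-1%g *m w).
have e (u : 'rV[R]_n) (x : 'cV[R]_n) : \sum_i u 0 i * x i 0 = (u *m x) 0 0 by rewrite mxE.
by rewrite e -mulmxA [gl_mx g *m _]mulmxA -gl_mxM mulgV gl_mx1 mul1mx -e vw.
Qed.

Lemma Um_joined_mul v (g : GL R n) : E g -> Um v -> joined Um v (v *m gl_mx g).
Proof.
move=> Eg; move: v; suff : @E R n `<=` [set g : GL R n | forall v, Um v ->
  joined Um v (v *m gl_mx g)] by apply.
apply: smallest_sub => [|_ [i [j [ij [r ->]]]] v Umv]; last first.
  have nil : nilpotent [set (i, j)]%SET.
    have ji : (j == i) = false by rewrite eq_sym (negPf ij).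
    split=> a b => [||c]; rewrite !inE !xpair_eqE => /andP[/eqP -> /eqP ->] //.
    - by rewrite ji.
    - by rewrite ji.
  apply: joined_step => //; first exact: Um_mul.
  apply: (frame2 nil) => //; apply: generated_sub.
  by exists i, j, ij, r; rewrite inE.
split=> [v Umv|s t Hs Ht v Umv|s Hs v Umv].
- rewrite gl_mx1 mulmx1; by exists (fun=> v); exact: const_path.
- rewrite gl_mxM mulmxA; apply: joined_trans (Hs _ Umv) _.
  by apply: Ht; exact: Um_mul.
- apply: joined_sym; have := Hs _ (Um_mul s^-1%g Umv).
  by rewrite -mulmxA -gl_mxM mulVg gl_mx1 mulmx1.
Qed.

Lemma joined_E X v w : joined X v w -> exists2 g : GL R n, E g & w = v *m gl_mx g.
Proof.
move=> [om [omF [M omM] [N omN]]].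
have [E1 EM EV] := @E_subgroup R n.
have step i : exists2 g : GL R n, E g & om (i + 1) = om i *m gl_mx g.
  have [_ _ [al [u [_ _ sub]]]] := omF i.
  have [g Lg omi] := sub (om i) (or_introl erefl).
  have [h Lh omi1] := sub (om (i + 1)) (or_intror erefl).
  exists (g^-1 * h)%g.
    by apply: EM; [apply: EV|]; apply: E_loc_sub; [exact: Lg|exact: Lh].
  by rewrite -omi -omi1 -mulmxA -gl_mxM mulVKg.
have steps i (k : nat) : exists2 g : GL R n, E g & om (i + k%:Z) = om i *m gl_mx g.
  elim: k => [|k [g Eg IH]]; first by exists 1%g; rewrite // addr0 gl_mx1 mulmx1.
  have [h Eh omh] := step (i + k%:Z); exists (g * h)%g; first exact: EM.
  by rewrite gl_mxM mulmxA -IH -omh -addrA -[k.+1]addn1 PoszD.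
have [g Eg] := steps M `|N - M|%N.
rewrite omN ?omM //; first by exists g.
rewrite -Num.Theory.lerBlDl abszE; exact: Num.Theory.ler_norm.
Qed.

End GlobalActions.

(* Right R-modules are left modules over the converse ring R^c; the right     *)
(* module R^k is 'cV[R^c]_k, on which a : R acts by w_i |-> w_i * a.          *)

Section Modules.
Variable S : pzRingType.
Implicit Types M N Q : lmodType S.

Definition lmod_iso M N := exists f : {linear M -> N}, bijective f.

Definition finitely_generated M := exists k (g : 'I_k -> M),
  forall x, exists c : 'I_k -> S, x = \sum_i c i *: g i.

Definition projective Q := forall M N (p : {linear M -> N}) (f : {linear Q -> N}),
  (forall y, exists x, p x = y) -> exists h : {linear Q -> M}, p \o h =1 f.

Lemma lmod_isoP M N : lmod_iso M N ->
  exists (f : {linear M -> N}) (g : {linear N -> M}), cancel f g /\ cancel g f.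
Proof.
move=> [f [g fK gK]].
pose h := GRing.isLinear.Build _ _ _ _ g (can2_linear fK gK).
by exists f, (HB.pack g h : {linear N -> M}).
Qed.

Lemma lmod_iso_of M N (f : M -> N) (g : N -> M) :
  linear f -> cancel f g -> cancel g f -> lmod_iso M N.
Proof.
move=> lf fK gK; pose h := GRing.isLinear.Build _ _ _ _ f lf.
by exists (HB.pack f h : {linear M -> N}); exists g.
Qed.

Lemma lmod_iso_refl M : lmod_iso M M.
Proof. by apply: (@lmod_iso_of _ _ id id). Qed.

Lemma lmod_iso_sym M N : lmod_iso M N -> lmod_iso N M.
Proof. by move=> /lmod_isoP[f [g [fK gK]]]; exists g, f. Qed.

Lemma lmod_iso_trans M N Q : lmod_iso M N -> lmod_iso N Q -> lmod_iso M Q.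
Proof.
by move=> [f fb] [g gb]; exists (g \o f); apply: bij_comp.
Qed.

Lemma retract_projective k Q (i : {linear Q -> 'cV[S]_k})
    (p : {linear 'cV[S]_k -> Q}) : cancel i p ->
  finitely_generated Q /\ projective Q.
Proof.
move=> ip.
have colE (x : 'cV[S]_k) : x = \sum_j x j 0 *: delta_mx j 0.
  rewrite [LHS]matrix_sum_delta; apply: eq_bigr => j _.
  by rewrite big_ord1 [ord0](ord1 0).
split.
  exists k, (fun j => p (delta_mx j 0)) => x; exists (fun j => i x j 0).
  rewrite -[LHS]ip [in LHS](colE (i x)) linear_sum.
  by apply: eq_bigr => j _; rewrite linearZ.
move=> M N q f qsurj.
have [m mE] := choice (fun j => qsurj (f (p (delta_mx j 0)))).
pose h x := \sum_j i x j 0 *: m j.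
have hl : linear h.
  move=> a x y; rewrite /h scaler_sumr -big_split /=; apply: eq_bigr => j _.
  by rewrite linearP !mxE scalerDl scalerA.
pose hL := GRing.isLinear.Build _ _ _ _ h hl.
exists (HB.pack h hL : {linear Q -> M}) => x /=.
rewrite -[in RHS](ip x) [in RHS](colE (i x)) !linear_sum.
by apply: eq_bigr => j _; rewrite !linearZ /= mE.
Qed.

(* representatives of the elements of K^s_{0,m} *)
Definition stably_free_of_rank (m : nat) Q : Prop :=
  [/\ finitely_generated Q, projective Q &
      exists r, lmod_iso (Q * 'cV[S]_r)%type 'cV[S]_(m + r)].

Definition K0s_ m := quotient (stably_free_of_rank m) lmod_iso.

Lemma lmod_iso_equiv (D : lmodType S -> Prop) : equiv_on D lmod_iso.
Proof.
split=> [M _|M N _ _|M N Q _ _ _]; first exact: lmod_iso_refl.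
  exact: lmod_iso_sym.
exact: lmod_iso_trans.
Qed.

Lemma stably_freeI m r Q : lmod_iso (Q * 'cV[S]_r)%type 'cV[S]_(m + r) ->
  stably_free_of_rank m Q.
Proof.
move=> QF; have [f [g [fK gK]]] := lmod_isoP QF.
have il : linear (fun x : Q => f (x, 0)).
  by move=> a x y; rewrite -linearP; congr (f (_, _)); rewrite /= scaler0 addr0.
pose iL := GRing.isLinear.Build _ _ _ _ _ il.
have pl : linear (fun x => (g x).1) by move=> a x y; rewrite linearP.
pose pL := GRing.isLinear.Build _ _ _ _ _ pl.
have [|fgQ pQ] := @retract_projective (m + r) Q
  (HB.pack (fun x : Q => f (x, 0)) iL : {linear Q -> 'cV[S]_(m + r)})
  (HB.pack (fun x => (g x).1) pL : {linear 'cV[S]_(m + r) -> Q}).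
  by move=> x /=; rewrite fK.
by split=> //; exists r.
Qed.

Lemma stably_free_free m : stably_free_of_rank m 'cV[S]_m.
Proof.
apply: (@stably_freeI _ 0); rewrite addn0.
apply: (@lmod_iso_of _ _ fst (fun x => (x, 0))) => // -[x y] /=.
by congr pair; apply/colP=> -[].
Qed.

Lemma stably_free_add m Q : stably_free_of_rank m Q ->
  stably_free_of_rank m.+1 (Q * S^o)%type.
Proof.
move=> [_ _ [r /lmod_isoP[f [g [fK gK]]]]]; apply: (@stably_freeI _ r).
pose F (x : Q * S^o * 'cV[S]_r) : 'cV[S]_(1 + (m + r)) :=
  col_mx (const_mx x.1.2) (f (x.1.1, x.2)).
pose G (y : 'cV[S]_(1 + (m + r))) : Q * S^o * 'cV[S]_r :=
  ((g (dsubmx y)).1, usubmx y 0 0, (g (dsubmx y)).2).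
apply: (@lmod_iso_of _ _ F G) => [a x y|[[x c] y]|y]; rewrite /F /G /=.
- rewrite scale_col_mx add_col_mx; congr col_mx; last exact: (linearP f a (x.1.1, x.2) (y.1.1, y.2)).
  by apply/colP=> i; rewrite !mxE.
- by rewrite col_mxKd col_mxKu fK mxE.
- rewrite -surjective_pairing gK -[RHS]vsubmxK; congr col_mx.
  by apply/colP=> i; rewrite mxE ord1.
Qed.

Lemma lmod_iso_add M N : lmod_iso M N -> lmod_iso (M * S^o)%type (N * S^o)%type.
Proof.
move=> /lmod_isoP[f [g [fK gK]]].
apply: (@lmod_iso_of _ _ (fun x => (f x.1, x.2)) (fun x => (g x.1, x.2))).
- by move=> a x y; rewrite /= linearP.
- by case=> x c /=; rewrite fK.
- by case=> x c /=; rewrite gK.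
Qed.

Section Kernel.
Variables (M N : lmodType S) (f : {linear M -> N}).

Definition ker_pred : {pred M} := [pred x | f x == 0].

Fact ker_submod : submod_closed ker_pred.
Proof.
split=> [|a x y]; rewrite !inE ?linear0 // => /eqP fx /eqP fy.
by rewrite linearP fx fy scaler0 addr0.
Qed.
HB.instance Definition _ := GRing.isSubmodClosed.Build S M ker_pred ker_submod.

Record kernel := Kernel { kernel_val :> M; _ : kernel_val \in ker_pred }.
HB.instance Definition _ := [isSub for kernel_val].
HB.instance Definition _ := [Choice of kernel by <:].
HB.instance Definition _ := [SubChoice_isSubLmodule of kernel by <:].

End Kernel.

End Modules.

Section RowKernel.
Variables (R : pzRingType) (n : nat).
Implicit Type v : 'rV[R]_n.

(* beta_v : R^n -> R, w |-> sum_i v_i w_i, the products being taken in R *)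
Definition beta_row v (w : 'cV[R^c]_n) : (R^c)^o :=
  \sum_i (v 0 i : R) * (w i 0 : R).

Fact beta_row_linear v : linear (beta_row v).
Proof.
move=> a x y; rewrite /beta_row.
have -> b : a *: (b : (R^c)^o) = (b : R) * (a : R) :> R by [].
rewrite mulr_suml -big_split; apply: eq_bigr => i _ /=; rewrite !mxE.
have -> : a * x i 0 = (x i 0 : R) * (a : R) :> R by [].
by rewrite [LHS]mulrDr mulrA.
Qed.
HB.instance Definition _ v :=
  GRing.isLinear.Build _ _ _ _ (beta_row v) (beta_row_linear v).

Definition ker_row v : lmodType R^c := kernel (beta_row v).

Lemma beta_rowB v : {morph beta_row v : x y / x - y}.
Proof. exact: linearB. Qed.

Lemma beta_rowD v : {morph beta_row v : x y / x + y}.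
Proof. exact: linearD. Qed.

(* a matrix over R, acting on the right R-module R^n by w |-> A w *)
Definition mulc (A : 'M[R]_n) (w : 'cV[R^c]_n) : 'cV[R^c]_n :=
  A *m (w : 'cV[R]_n).

Fact mulc_linear A : linear (mulc A).
Proof.
move=> a x y; apply/colP=> i; rewrite !mxE.
have -> (b c : R^c) : a * b + c = (b : R) * (a : R) + c :> R by [].
rewrite mulr_suml -big_split; apply: eq_bigr => j _ /=; rewrite !mxE.
have -> : a * x j 0 = (x j 0 : R) * (a : R) :> R by [].
by rewrite [LHS]mulrDr mulrA.
Qed.

Lemma beta_rowE v (w : 'cV[R^c]_n) :
  beta_row v w = (v *m (w : 'cV[R]_n)) 0 0.
Proof. by rewrite mxE. Qed.

Lemma beta_row_mulc v A w : beta_row v (mulc A w) = beta_row (v *m A) w.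
Proof. by rewrite !beta_rowE mulmxA. Qed.

Lemma ker_rowP v (w : ker_row v) : beta_row v (\val w) = 0.
Proof. exact/eqP/(valP w). Qed.

Lemma ker_rowI v w : beta_row v w = 0 -> w \in ker_pred (beta_row v).
Proof. by move/eqP. Qed.

Lemma ker_row_mul v (g : GL R n) :
  lmod_iso (ker_row v) (ker_row (v *m gl_mx g)).
Proof.
have H1 (w : ker_row v) :
    mulc (gl_mx g^-1%g) (\val w) \in ker_pred (beta_row (v *m gl_mx g)).
  apply: ker_rowI; rewrite beta_row_mulc -mulmxA -gl_mxM mulgV gl_mx1 mulmx1.
  exact: ker_rowP.
have H2 (w : ker_row (v *m gl_mx g)) :
    mulc (gl_mx g) (\val w) \in ker_pred (beta_row v).
  by apply: ker_rowI; rewrite beta_row_mulc; exact: ker_rowP.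
apply: (@lmod_iso_of _ _ _ (fun w => Kernel (H1 w)) (fun w => Kernel (H2 w))).
- move=> a x y; apply: val_inj; rewrite /= -mulc_linear //.
- by move=> w; apply: val_inj; rewrite /= /mulc mulmxA -gl_mxM mulgV mul1mx.
- by move=> w; apply: val_inj; rewrite /= /mulc mulmxA -gl_mxM mulVg mul1mx.
Qed.

Lemma ker_row_joined v w : joined (@Um R n) v w ->
  lmod_iso (ker_row v) (ker_row w).
Proof. by move=> /joined_E[g _ ->]; exact: ker_row_mul. Qed.

Lemma ker_row_stably_free m v : n = m.+1 -> Um v ->
  stably_free_of_rank m (ker_row v).
Proof.
move=> nm [u vu]; apply: (@stably_freeI _ _ 1); rewrite addn1 -nm.
pose b (c : R^c) : 'cV[R^c]_n := c *: (u : 'cV[R^c]_n).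
have beta_b c : beta_row v (b c) = c.
  transitivity (c *: beta_row v u); first exact: linearZ.
  have -> : beta_row v u = 1 by exact: vu.
  exact: mulr1.
have H (y : 'cV[R^c]_n) : y - b (beta_row v y) \in ker_pred (beta_row v).
  by apply: ker_rowI; rewrite beta_rowB beta_b subrr.
pose F (x : ker_row v * 'cV[R^c]_1) : 'cV[R^c]_n := \val x.1 + b (x.2 0 0).
pose G y : ker_row v * 'cV[R^c]_1 := (Kernel (H y), const_mx (beta_row v y)).
apply: (@lmod_iso_of _ _ _ F G) => [a x y|[x c]|y]; rewrite /F /G.
- rewrite /= /b !mxE scalerDl -scalerA scalerDr.
  by rewrite addrACA.
- have bx : beta_row v (\val x + b (c 0 0)) = c 0 0.
    by rewrite beta_rowD ker_rowP beta_b add0r.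
  congr pair; last by apply/colP=> i; rewrite mxE ord1 /= bx.
  by apply: val_inj; rewrite /= bx addrK.
- by rewrite /= mxE subrK.
Qed.

End RowKernel.

(* Throughout this section n = m + 1 is the index of the sequence: K_2, pi_1,  *)
(* pi_0 are taken at n, and K1_mod_K12 at n - 1 = m.                          *)

Section Sequence.
Variables (R : pzRingType) (m : nat).

Definition K2 : set (St R m.+1) := [set x | theta x = 1%g].

Fact K2_1 : K2 1%g.
Proof. by apply: (@mulgI _ (theta 1%g)); rewrite -thetaM !mulg1. Qed.

Fact K2_2_1 : (K2 `&` @Pt2 R m) 1%g.
Proof.
split; first exact: K2_1.
by have [? _ _] : is_subgroup (@Pt2 R m) by exact: generated_subgroup.
Qed.

Fact K2_sub : K2 `<=` @Pt R m.
Proof.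
move=> x; rewrite /K2 /Pt /= => ->.
by have [? _ _] := @EP_subgroup R m.
Qed.

Definition K_2 : pointedSet := @PointedSet {x | K2 x} (exist _ _ K2_1).
Definition K_22 : pointedSet :=
  @PointedSet {x | (K2 `&` @Pt2 R m) x} (exist _ _ K2_2_1).

Definition delta (x : K_22) : K_2 :=
  let: exist x (conj K2x _) := x in exist K2 x K2x.

Definition EUm : set 'rV[R]_m.+1 :=
  [set @e_row R m *m gl_mx g | g in @E R m.+1].

Fact EUm_e : EUm (@e_row R m).
Proof.
have [E1 _ _] := @E_subgroup R m.+1.
by exists 1%g; rewrite // gl_mx1 mulmx1.
Qed.

Definition pi_1 : pointedSet :=
  @PointedSet (pi1 EUm (@e_row R m))
    (@cls _ (loops EUm (@e_row R m)) _ (fun=> @e_row R m) (const_path EUm_e)).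

Definition Pt_Pt2 := cosets (@Pt R m) (@Pt2 R m).

(* The path e, e g_1, e g_1 g_2, ..., e g_1 ... g_N with g_k = theta x_k,     *)
(* xs = [:: x_1; ...; x_N], starting to move at time a.                       *)
Definition word_path (a : int) (xs : seq (St R m.+1)) : int -> 'rV[R]_m.+1 :=
  fun i => @e_row R m *m
    gl_mx (theta (\prod_(x <- take (absz (Num.max 0 (i - a))%R) xs) x)%g).

(* The path lifting property of a map pi_1(EUm_n(R)) -> Pt/Pt2; as every loop *)
(* is some word_path of local elements, at most one map has it.               *)
Definition path_lifting (lift : pi_1 -> Pt_Pt2) :=
  forall (a : int) (xs : seq (St R m.+1))
         (loop_xs : loops EUm (@e_row R m) (word_path a xs))
         (Pt_xs : @Pt R m (\prod_(x <- xs) x)%g),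
    (forall x, x \in xs -> exists2 al, nilpotent al & St_loc al x) ->
    lift (cls _ loop_xs) = cls _ Pt_xs.

(* eta and mu, with Pt/Pt2 in place of pi_1(EUm_n(R))                         *)

Definition eta (Y : K_2) : Pt_Pt2 := cls _ (K2_sub (proj2_sig Y)).

Definition K1_mod_K12 : pointedSet :=
  @PointedSet (cosets setT (@GL_EP2 R m)) (@cls _ setT _ 1%g I).

Definition mu : Pt_Pt2 -> K1_mod_K12 :=
  quotient_map (same_lcoset_equiv _ (generated_subgroup _))
    (same_lcoset_equiv setT (@GL_EP2_subgroup R m))
    (fun _ _ => I) (@rd_theta_coset R m).

Lemma mu_cls Y (PtY : @Pt R m Y) :
  mu (cls _ PtY) = @cls _ setT _ (rd (theta Y)) I.
Proof. exact: quotient_map_cls. Qed.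

Definition K_1 (k : nat) : pointedSet :=
  @PointedSet (cosets setT (@E R k)) (@cls _ setT _ 1%g I).

Definition lambda : K1_mod_K12 -> K_1 m.+1 :=
  quotient_map (same_lcoset_equiv setT (@GL_EP2_subgroup R m))
    (same_lcoset_equiv setT (@E_subgroup R m.+1))
    (fun _ _ => I) (fun s t _ _ => @emb_coset R m s t).

Lemma lambda_cls t : lambda (@cls _ setT _ t I) = @cls _ setT _ (emb t) I.
Proof. exact: quotient_map_cls. Qed.

Fact Um_e : @Um R m.+1 (@e_row R m).
Proof.
exists (delta_mx 0 0); rewrite (bigD1 0) //= big1 => [|i /negPf i0].
  by rewrite !mxE eqxx mulr1 addr0.
by rewrite !mxE i0 mulr0.
Qed.

Definition pi_0 : pointedSet :=
  @PointedSet (pi0 (@Um R m.+1)) (cls _ Um_e).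

Fact alpha_joined (s t : GL R m.+1) : same_lcoset (@E R m.+1) s t ->
  joined (@Um R m.+1) (@e_row R m *m gl_mx s) (@e_row R m *m gl_mx t).
Proof.
move=> st; have := Um_joined_mul st (Um_mul s Um_e).
by rewrite -mulmxA -gl_mxM mulVKg.
Qed.

Definition alpha : K_1 m.+1 -> pi_0 :=
  quotient_map (same_lcoset_equiv setT (@E_subgroup R m.+1))
    (@joined_equiv R m.+1 (@Um R m.+1))
    (fun s _ => Um_mul s Um_e) (fun s t _ _ => @alpha_joined s t).

Lemma alpha_cls s :
  alpha (@cls _ setT _ s I) = cls _ (Um_mul s Um_e).
Proof. exact: quotient_map_cls. Qed.

Definition K0s (k : nat) : pointedSet :=
  @PointedSet (K0s_ R^c k) (cls _ (stably_free_free R^c k)).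

Definition beta : pi_0 -> K0s m :=
  quotient_map (@joined_equiv R m.+1 (@Um R m.+1))
    (lmod_iso_equiv (stably_free_of_rank m))
    (fun v => @ker_row_stably_free R m.+1 m v erefl)
    (fun v w _ _ => @ker_row_joined R m.+1 v w).

Lemma beta_cls v (Umv : Um v) :
  beta (cls _ Umv) = cls _ (@ker_row_stably_free R m.+1 m v erefl Umv).
Proof. exact: quotient_map_cls. Qed.

Definition gamma : K0s m -> K0s m.+1 :=
  quotient_map (lmod_iso_equiv (stably_free_of_rank m))
    (lmod_iso_equiv (stably_free_of_rank m.+1))
    (@stably_free_add R^c m) (fun Q Q' _ _ => @lmod_iso_add R^c Q Q').

Lemma gamma_cls Q (sfQ : stably_free_of_rank m Q) :
  gamma (cls _ sfQ) = cls _ (stably_free_add sfQ).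
Proof. exact: quotient_map_cls. Qed.

End Sequence.

(* Main.v *)
From HB Require Import structures.
Require Import Defs.
From mathcomp Require Import all_boot all_order all_algebra.
From mathcomp Require Import zify.
From mathcomp Require Import boolp classical_sets functions cardinality.

(** The part of the sequence up to pi_1 is covering theory, the rest is algebra.

    Topological part.  Send y in St_n(R) to the row e theta(y).  Modulo left
    multiplication by Pt2 this is a covering of EUm_n(R), whose fibre over e is
    Pt / Pt2: if x in St_al and x' in St_be lift the same step from e theta(y),
    then y x x'^-1 y^-1 fixes e and has the shape that generates Pt2
    [lift_step_unique].  Hence the steps of a path lift uniquely modulo Pt2,
    and so do the squares of a stable homotopy [lifts_over_strip]; the
    endpoint of the lift, in Pt / Pt2, is an invariant of the homotopy class of
    a loop [homotopic_lcoset].  This invariant separates classes because the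
    total space is simply connected.  Every Steinberg relation takes place
    inside one St_al with al nilpotent, and a word in one St_al can be deformed
    to any other word in St_al with the same product, so words equal in St_n(R)
    give homotopic paths [word_htpy_wprod].  A generator z^-1 a b z of Pt2
    contributes a detour along z^-1, a step by a, the same step back by b, and
    the return along z; it contracts [word_htpy_conj].  The resulting bijection
    pi_1 = Pt / Pt2 is [lifting_bijection].

    Algebraic part.  Left of K_1, exactness is a computation with cosets which
    rests on two facts: theta maps Pt2 onto EP2 [EP2_theta], and a matrix
    (1 0; v tau) differs from (1 0; 0 tau) by an element of a local subgroup
    E_n(R)_al fixing e, hence of EP2 [emb_rd_coset].  Exactness at K_1 uses the
    same factorization.  On the side of K_0, a unimodular v gives an
    isomorphism f : ker beta_v + R -> R^n whose composite with beta_v is the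
    second projection, and conversely an isomorphism Q + R -> R^n defines such
    a v with kernel Q [ker_splits, iso_splits].  Two rows for which the same Q
    arises differ by an element of GL_n(R) [splits_GL].

    Each map after the first is pointed because its kernel contains the image
    of the base point under the preceding one. *)

Set Implicit Arguments.
Unset Strict Implicit.
Unset Printing Implicit Defensive.

Import Order.TTheory GRing.Theory.
Local Open Scope classical_set_scope.
Local Open Scope ring_scope.

(** * Quotients and morphisms *)

Lemma cls_inj T (D : T -> Prop) R x y (Dx : D x) (Dy : D y) :
  equiv_on D R -> cls R Dx = cls R Dy -> R x y.
Proof.
move=> [reflR _ _] /(congr1 (fun C : quotient D R => qclass C y)) /= xy.
suff [] : D y /\ R x y by [].
by rewrite xy; split=> //; apply: reflR.
Qed.

Lemma quotientP T (D : T -> Prop) R (C : quotient D R) :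
  exists x (Dx : D x), C = cls R Dx.
Proof.
by have [x Dx Cx] := qclassP C; exists x, Dx; apply: quotient_inj; rewrite Cx.
Qed.

Section Subgroups.
Local Open Scope group_scope.
Variables (G G' : groupType) (f : G -> G').
Hypothesis fM : {morph f : x y / x * y}.

Lemma morph1 : f 1 = 1.
Proof. by apply: (@mulgI _ (f 1)); rewrite -fM !mulg1. Qed.

Lemma morphV x : f x^-1 = (f x)^-1.
Proof. by apply: (@mulgI _ (f x)); rewrite -fM !mulgV morph1. Qed.

Lemma generated_image (A : set G') (H : set G) :
  is_subgroup H -> A `<=` f @` H -> generated A `<=` f @` H.
Proof.
move=> [H1 HM HV] AH; apply: smallest_sub => //; split.
- by exists 1; rewrite ?morph1.
- by move=> _ _ [x Hx <-] [y Hy <-]; exists (x * y); rewrite ?fM //; apply: HM.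
- by move=> _ [x Hx <-]; exists x^-1; rewrite ?morphV //; apply: HV.
Qed.

End Subgroups.

Lemma frame_sub (R : pzRingType) n X (F F' : set 'rV[R]_n) :
  F' !=set0 -> F' `<=` F -> local_frame X F -> local_frame X F'.
Proof.
move=> F'0 F'F [_ Ffin [al [v [nil Xv Fv]]]]; split=> //.
  exact: sub_finite_set F'F Ffin.
by exists al, v; split=> //; apply: subset_trans Fv.
Qed.

(** * The covering of EUm_n(R) by the Steinberg group *)

Section Covering.
Variables (R : pzRingType) (m : nat).
Local Notation St := (St R m.+1).
Local Notation e := (e_row R m).
Local Notation EUm := (@EUm R m).
Local Notation Pt := (@Pt R m).
Local Notation Pt2 := (@Pt2 R m).
Implicit Types (x y z a b c : St) (al be : {set 'I_m.+1 * 'I_m.+1}).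

Lemma theta1 : theta 1%g = 1%g :> GL R m.+1.
Proof. exact: morph1 (@thetaM R m.+1). Qed.

Lemma thetaV x : theta x^-1%g = (theta x)^-1%g.
Proof. exact: morphV (@thetaM R m.+1) x. Qed.

Lemma St_locP al : is_subgroup (@St_loc R m.+1 al).
Proof. exact: generated_subgroup. Qed.

Lemma E_loc_theta al : @E_loc R m.+1 al `<=` @theta R m.+1 @` St_loc al.
Proof.
apply: (generated_image (@thetaM R m.+1) (St_locP al)).
move=> _ [i [j [ij [r [ijal ->]]]]]; exists (stein ij r).
  by apply: generated_sub; exists i, j, ij, r.
exact: theta_stein.
Qed.

Lemma E_theta : @E R m.+1 `<=` range (@theta R m.+1).
Proof.
apply: (generated_image (@thetaM R m.+1)) => [|_ [i [j [ij [r ->]]]]].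
  by split.
by exists (stein ij r) => //; exact: theta_stein.
Qed.

(** The projection of the covering; its fibre over e is Pt. *)
Definition proj (y : St) : 'rV[R]_m.+1 := e *m gl_mx (theta y).

Lemma projM y x : proj (y * x)%g = proj y *m gl_mx (theta x).
Proof. by rewrite /proj thetaM gl_mxM mulmxA. Qed.

Lemma proj1 : proj 1%g = e.
Proof. by rewrite /proj theta1 gl_mx1 mulmx1. Qed.

Lemma proj_mulr y z x : proj y = proj z -> proj (y * x)%g = proj (z * x)%g.
Proof. by rewrite !projM => ->. Qed.

Lemma PtE y : Pt y <-> proj y = e.
Proof. by split=> [[]//|py]; split=> //; exact: theta_E. Qed.

Lemma Pt_subgroup : is_subgroup Pt.
Proof.
have [P1 PM PV] := @EP_subgroup R m; split=> [|x y Px Py|x Px]; rewrite /Pt /=.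
- by rewrite theta1.
- by rewrite thetaM; apply: PM.
- by rewrite thetaV; apply: PV.
Qed.

Lemma Pt2_subgroup : is_subgroup Pt2.
Proof. exact: generated_subgroup. Qed.

Lemma EUm_proj y : EUm (proj y).
Proof. by exists (theta y) => //; exact: theta_E. Qed.

Definition local x := exists2 al, nilpotent al & St_loc al x.

Lemma local1 : local 1%g.
Proof.
by exists finset.set0; [exact: nilpotent0 | have [] := St_locP finset.set0].
Qed.

Lemma localV x : local x -> local x^-1%g.
Proof. by move=> [al nil Lx]; exists al => //; have [_ _] := St_locP al; apply. Qed.

(** A local frame consists of rows u g with g in one E_al, and a point of the
    frame can serve as the origin instead of u; this makes it liftable over any
    point of the fibre above that origin. *)
Lemma frame_lift (F : set 'rV[R]_m.+1) y : local_frame EUm F -> F (proj y) ->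
  exists2 al, nilpotent al &
    forall v, F v -> exists2 a, St_loc al a & v = proj (y * a)%g.
Proof.
move=> [_ _ [al [u [nil _ sub]]]] Fy; exists al => // v Fv.
have [_ LM LV] := St_locP al.
have [g /E_loc_theta[b Lb <-] uy] := sub _ Fy.
have [h /E_loc_theta[c Lc <-] <-] := sub _ Fv.
exists (b^-1 * c)%g; first by apply: LM => //; apply: LV.
by rewrite projM -uy -mulmxA -gl_mxM thetaM thetaV mulVKg.
Qed.

Lemma frame_of al y (F : set 'rV[R]_m.+1) : nilpotent al ->
  F !=set0 -> finite_set F ->
  (forall v, F v -> exists2 a, St_loc al a & v = proj (y * a)%g) ->
  local_frame EUm F.
Proof.
move=> nil F0 Ffin FE; split=> //; exists al, (proj y).
split=> //; first exact: EUm_proj.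
move=> v /FE[a La ->]; exists (theta a); first exact: theta_St_loc.
by rewrite projM.
Qed.

(** Right cosets, whereas Pt / Pt2 is made of left ones: local elements act
    on the right, so Pt2 has to act on the left in the covering.  On Pt the two
    relations agree, see [same_sheet_lcoset]. *)
Definition same_sheet y z := Pt2 (y * z^-1)%g.

Lemma same_sheet_sym y z : same_sheet y z -> same_sheet z y.
Proof.
have [_ _ V] := Pt2_subgroup.
by move=> /V; rewrite /same_sheet invgM invgK.
Qed.

Lemma same_sheet_trans x y z :
  same_sheet x y -> same_sheet y z -> same_sheet x z.
Proof.
have [_ M _] := Pt2_subgroup => xy yz; have := M _ _ xy yz.
by rewrite /same_sheet mulgA mulgVK.
Qed.

Lemma same_sheet_mulr x y z : same_sheet y z -> same_sheet (y * x)%g (z * x)%g.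
Proof. by rewrite /same_sheet invgM mulgA mulgK. Qed.

(** The quotient y a b^-1 y^-1 of the two endpoints fixes e, and it is literally
    one of the elements that generate Pt2. *)
Lemma lift_step_unique y a b : local a -> local b ->
  proj (y * a)%g = proj (y * b)%g -> same_sheet (y * a)%g (y * b)%g.
Proof.
move=> [al nila La] [be nilb Lb] ab; apply: generated_sub; split.
  apply/PtE; rewrite (proj_mulr _ ab) mulgV proj1 //.
exists al, be, y^-1%g, a, b^-1%g; split=> //.
  by have [_ _] := St_locP be; apply.
by rewrite invgK invgM !mulgA.
Qed.

(** Uniqueness of lifts over a strip of squares, one row of a homotopy.  The
    comparison is along the vertical edges: a local lift c of the edge from
    proj (y i) to proj (z i) is not unique, hence the induction proves the
    conclusion for every such c.  In the step, the corners of the square lift to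
    y i, y i a, y i d, y i b with a, b, d in the same St_al. *)
Lemma lifts_over_strip (y z : int -> St) (N : int) :
  (forall i, (i <= N)%R -> y i = 1%g /\ z i = 1%g) ->
  (forall i, local ((y i)^-1 * y (i + 1))%g) ->
  (forall i, local ((z i)^-1 * z (i + 1))%g) ->
  (forall i, local_frame EUm [set proj (y i); proj (y (i + 1));
                                  proj (z i); proj (z (i + 1))]) ->
  forall i, (N <= i)%R -> forall c, local c ->
    proj (z i) = proj (y i * c)%g -> same_sheet (z i) (y i * c)%g.
Proof.
move=> yz1 yL zL F i Ni.
have -> : i = N + `|i - N|%N%:Z by lia.
elim: `|i - N|%N => {i Ni} [|k IH] c Lc.
  have [] := yz1 (N + 0%:Z) _; first by lia.
  move=> -> ->; rewrite mul1g => e1.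
  rewrite -[1%g]mulg1 -[c]mul1g; apply: lift_step_unique => //; first exact: local1.
  by rewrite mulg1 mul1g.
have -> : N + k.+1%:Z = N + k%:Z + 1 by lia.
set i := N + k%:Z in IH * => zyc.
have [|al nil sq] := frame_lift (y := y i) (F i); first by do 3 left.
have [_ LM LV] := St_locP al.
have loc x : St_loc al x -> local x by exists al.
have [a La ya] := sq (proj (y (i + 1))) (or_introl (or_introl (or_intror erefl))).
have [d Ld zd] := sq (proj (z i)) (or_introl (or_intror erefl)).
have [b Lb zb] := sq (proj (z (i + 1))) (or_intror erefl).
have zid : same_sheet (z i) (y i * d)%g by apply: IH => //; apply: loc.
have yia : same_sheet (y (i + 1)) (y i * a)%g.
  rewrite -[y (i + 1)](mulVKg (y i)).
  apply: lift_step_unique => //; first exact: loc.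
  by rewrite mulVKg.
have Lab := loc _ (LM _ _ (LV _ La) Lb); have Ldb := loc _ (LM _ _ (LV _ Ld) Lb).
have zib : same_sheet (z (i + 1)) (y i * b)%g.
  apply: (@same_sheet_trans _ (z i * (d^-1 * b))%g).
    rewrite -[z (i + 1)](mulVKg (z i)); apply: lift_step_unique => //.
    by rewrite mulVKg zb (proj_mulr _ zd) -!mulgA mulVKg.
  have -> : (y i * b = y i * d * (d^-1 * b))%g by rewrite -mulgA mulVKg.
  exact: same_sheet_mulr.
apply: (same_sheet_trans zib).
have yib : same_sheet (y i * b)%g (y (i + 1) * (a^-1 * b))%g.
  apply: same_sheet_sym.
  have -> : (y i * b = y i * a * (a^-1 * b))%g by rewrite -mulgA mulVKg.
  exact: same_sheet_mulr.
apply: (same_sheet_trans yib).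
apply: lift_step_unique => //; by rewrite -zyc zb (proj_mulr _ ya) -!mulgA mulVKg.
Qed.

(** Pt2 is normal in Pt, since conjugation by Pt permutes its generators. *)
Lemma same_sheet_lcoset y z : Pt y -> same_sheet z y -> same_lcoset Pt2 y z.
Proof.
move=> Pty zy; have [P1 PM PV] := Pt_subgroup.
rewrite /same_lcoset; have -> : (y^-1 * z = y^-1 * (z * y^-1) * y)%g.
  by rewrite mulgA mulgVK.
have : [set u | Pt2 (y^-1 * u * y)%g] (z * y^-1)%g; last by [].
have [G1 GM GV] := Pt2_subgroup.
move: zy; rewrite /same_sheet; move: (z * y^-1)%g.
apply: smallest_sub => [|u [Ptu [al [be [x [a [b [nil _ La Lb defu]]]]]]]].
  split=> /= [|u v Gu Gv|u Gu].
  - by rewrite mulg1 mulVg.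
  - by have := GM _ _ Gu Gv; rewrite !mulgA mulgK.
  - by have := GV _ Gu; rewrite !invgM invgK mulgA.
apply: generated_sub; split.
  exact: (PM _ _ (PM _ _ (PV _ Pty) Ptu) Pty).
by exists al, be, (x * y)%g, a, b; rewrite defu invgM !mulgA.
Qed.

End Covering.

(** * Stable homotopy of paths *)

Section StableHomotopy.
Variables (R : pzRingType) (n : nat) (X : set 'rV[R]_n).
Implicit Types om : int -> 'rV[R]_n.

Lemma path_ends om v w v' w' : is_path X om v w -> is_path X om v' w' ->
  v = v' /\ w = w'.
Proof.
move=> [_ [N omN] [M omM]] [_ [N' omN'] [M' omM']]; split.
  rewrite -(omN (Order.min N N')) ?(omN' (Order.min N N')) //; lia.
rewrite -(omM (Order.max M M')) ?(omM' (Order.max M M')) //; lia.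
Qed.

Lemma stably_homotopic_refl om v w : is_path X om v w -> stably_homotopic X om om.
Proof.
move=> omP; exists (fun i _ => om i); split.
- move=> i k; have [F _ _] := omP; apply: frame_sub (F i).
    by exists (om i); left; left; left.
  by move=> u [[[]|]|] ->; [left|right|left|right].
- by exists v, w.
- by exists 0.
- by exists 0.
Qed.

Lemma stably_homotopic_sym om om' :
  stably_homotopic X om om' -> stably_homotopic X om' om.
Proof.
move=> [H [HF [v [w HP]] [N HN] [M HM]]]; exists (fun i k => H i (- k)); split.
- move=> i k; apply: frame_sub (HF i (- (k + 1))).
    by exists (H i (- k)); left; left; left.
  have -> : - (k + 1) + 1 = - k by lia.
  by move=> u [[[]|]|] ->; [left; right|right|left; left; left|left; left; right].
- by exists v, w => k; exact: HP.
- by exists (- M) => k kM; apply: HM; lia.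
- by exists (- N) => k kN; apply: HN; lia.
Qed.

Lemma stably_homotopic_trans om om' om'' : stably_homotopic X om om' ->
  stably_homotopic X om' om'' -> stably_homotopic X om om''.
Proof.
move=> [H [HF [v [w HP]] [N HN] [M HM]]] [K [KF [v' [w' KP]] [N' KN] [M' KM]]].
have HK i : H i M = K i N'.
  have /(congr1 (@^~ i)) /= -> := HM M (lexx _).
  by have /(congr1 (@^~ i)) /= -> := KN N' (lexx _).
have [vv ww] : v = v' /\ w = w'.
  apply: (path_ends (HP M)); rewrite (HM M) // -(KN N') //; exact: KP.
exists (fun i k => if (k <= M)%R then H i k else K i (k - M + N')); split.
- move=> i k; have [kM|Mk] := boolP (k + 1 <= M)%R.
    have -> : (k <= M)%R by lia.
    exact: HF.
  have [kM|kM] := boolP (k <= M)%R; last first.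
    have -> : k + 1 - M + N' = k - M + N' + 1 by lia.
    exact: KF.
  have -> : k = M by lia.
  rewrite !HK; have -> : M + 1 - M + N' = N' + 1 by lia.
  exact: KF.
- exists v, w => k; case: (k <= M)%R; first exact: HP.
  by rewrite vv ww; exact: KP.
- exists (Order.min N M) => k kNM; have -> : (k <= M)%R by lia.
  by apply: HN; lia.
- exists (Order.max (M + 1) (M' - N' + M)) => k kM.
  have -> : (k <= M)%R = false by lia.
  by apply: KM; lia.
Qed.

(** A homotopy may change one point at a time: all its squares but the two next
    to that point are degenerate. *)
Lemma move_point om om' v w p : is_path X om v w -> is_path X om' v w ->
  (forall i, i != p -> om i = om' i) ->
  local_frame X [set om (p - 1); om p; om' p] ->
  local_frame X [set om p; om' p; om (p + 1)] ->
  stably_homotopic X om om'.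
Proof.
move=> omP omP' omE F1 F2.
exists (fun i k => if (k <= 0)%R then om i else om' i); split.
- move=> i k; have [omF _ _] := omP; have [omF' _ _] := omP'.
  have [k0|k0] := boolP (k + 1 <= 0)%R.
    have -> : (k <= 0)%R by lia.
    apply: frame_sub (omF i); first by exists (om i); left; left; left.
    by move=> u [[[]|]|] ->; [left|right|left|right].
  have [k1|k1] := boolP (k <= 0)%R; last first.
    apply: frame_sub (omF' i); first by exists (om' i); left; left; left.
    by move=> u [[[]|]|] ->; [left|right|left|right].
  have [ip|ip] := eqVneq i p.
    rewrite ip -(omE (p + 1)); last lia.
    apply: frame_sub F2; first by exists (om p); left; left; left.
    by move=> u [[[]|]|] ->; [left; left|right|left; right|right].
  have [ip1|ip1] := eqVneq (i + 1) p.
    rewrite ip1 -(omE i) //; have -> : i = p - 1 by lia.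
    apply: frame_sub F1; first by exists (om p); left; left; right.
    by move=> u [[[]|]|] ->; [left; left|left; right|left; left|right].
  rewrite -!omE //; apply: frame_sub (omF i).
    by exists (om i); left; left; left.
  by move=> u [[[]|]|] ->; [left|right|left|right].
- by exists v, w => k; case: (k <= 0)%R.
- by exists 0 => k k0; apply/funext => i; rewrite /= k0.
- by exists 1 => k k1; apply/funext => i /=; case: ifP => //; lia.
Qed.

End StableHomotopy.

(** * Paths as words in local elements *)

Section Words.
Variables (R : pzRingType) (m : nat).
Local Notation St := (St R m.+1).
Local Notation e := (e_row R m).
Local Notation EUm := (@EUm R m).
Local Notation Pt := (@Pt R m).
Local Notation Pt2 := (@Pt2 R m).
Local Notation wprod xs := (\prod_(x <- xs) x)%g.
Implicit Types (x y a b c d : St) (l r xs ys : seq St) (N : int)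
  (al be : {set 'I_m.+1 * 'I_m.+1}).

(** The lift of [word_path N xs] that starts at 1. *)
Definition wlift N xs : int -> St :=
  fun i => wprod (take (absz (Num.max 0 (i - N))%R) xs).

Lemma word_pathE N xs i : word_path N xs i = proj (wlift N xs i).
Proof. by []. Qed.

Lemma wlift_start N xs i : (i <= N)%R -> wlift N xs i = 1%g.
Proof.
move=> iN; rewrite /wlift; have -> : absz (Num.max 0 (i - N)) = 0%N by lia.
by rewrite take0 big_nil.
Qed.

Lemma wlift_nat N xs (k : nat) : wlift N xs (N + k%:Z) = wprod (take k xs).
Proof. by rewrite /wlift; have -> : absz (Num.max 0 (N + k%:Z - N)) = k by lia. Qed.

Lemma wlift_end N xs i : (N + (size xs)%:Z <= i)%R -> wlift N xs i = wprod xs.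
Proof.
move=> iN; have -> : i = N + `|i - N|%N%:Z by lia.
by rewrite wlift_nat take_oversize //; lia.
Qed.

Lemma wlift_cases N i : (i <= N)%R \/ exists k : nat, i = N + k%:Z.
Proof. by have [|iN] := boolP (i <= N)%R; [left|right; exists `|i - N|%N; lia]. Qed.

Lemma wprod_take_nth (k : nat) xs :
  (wprod (take k.+1 xs) = wprod (take k xs) * nth 1 xs k)%g.
Proof.
have [kxs|kxs] := ltnP k (size xs).
  by rewrite (take_nth 1%g) // -cats1 big_cat /= big_seq1.
by rewrite nth_default // mulg1 !take_oversize // leqW.
Qed.

Definition local_word xs := forall x, x \in xs -> local x.

Lemma local_cat xs ys : local_word xs -> local_word ys -> local_word (xs ++ ys).
Proof. by move=> Lx Ly z; rewrite mem_cat => /orP[/Lx|/Ly]. Qed.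

Lemma local_nil : local_word [::]. Proof. by []. Qed.

Lemma local_cons x xs : local x -> local_word xs -> local_word (x :: xs).
Proof. by move=> Lx Lxs y; rewrite inE => /orP[/eqP ->|/Lxs]. Qed.

Lemma wlift_local N xs i :
  local_word xs -> local ((wlift N xs i)^-1 * wlift N xs (i + 1))%g.
Proof.
move=> Lxs; have [iN|iN] := boolP (i + 1 <= N)%R.
  rewrite !wlift_start //; last lia.
  by rewrite mulVg; exact: local1.
have -> : i = N + `|i - N|%N%:Z by lia.
rewrite -addrA -[X in _ + (_ + X)]/(1%N%:Z) -PoszD addn1 !wlift_nat.
rewrite wprod_take_nth mulKg.
have [kxs|kxs] := ltnP `|i - N|%N (size xs); first exact/Lxs/mem_nth.
by rewrite nth_default //; exact: local1.
Qed.

Lemma lift_frame2 y a : local a -> local_frame EUm [set proj y; proj (y * a)%g].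
Proof.
move=> [al nil La]; have [L1 LM LV] := St_locP R al.
apply: (@frame_of R m al y) => //; first by exists (proj y); left.
by move=> v [->|->]; [exists 1%g; rewrite ?mulg1|exists a].
Qed.

Lemma lift_frame3 al y a b : nilpotent al -> St_loc al a -> St_loc al b ->
  local_frame EUm [set proj y; proj (y * a)%g; proj (y * b)%g].
Proof.
move=> nil La Lb; have [L1 LM LV] := St_locP R al.
apply: (@frame_of R m al y) => //; first by exists (proj y); left; left.
by move=> v [[->|->]|->]; [exists 1%g; rewrite ?mulg1|exists a|exists b].
Qed.

Lemma word_pathP N xs : local_word xs ->
  is_path EUm (word_path N xs) e (proj (wprod xs)).
Proof.
move=> Lxs; split.
- move=> i; rewrite !word_pathE; rewrite -[wlift N xs (i + 1)](mulVKg (wlift N xs i)).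
  by apply: lift_frame2; exact: wlift_local.
- by exists N => i iN; rewrite word_pathE wlift_start // proj1.
- by exists (N + (size xs)%:Z) => i iN; rewrite word_pathE wlift_end.
Qed.

Definition word_htpy N xs ys := stably_homotopic EUm (word_path N xs) (word_path N ys).

Lemma word_htpy_refl N xs : local_word xs -> word_htpy N xs xs.
Proof. by move=> Lxs; apply: stably_homotopic_refl (word_pathP N Lxs). Qed.

Lemma word_htpy_sym N xs ys : word_htpy N xs ys -> word_htpy N ys xs.
Proof. exact: stably_homotopic_sym. Qed.

Lemma word_htpy_trans N ys xs zs :
  word_htpy N xs ys -> word_htpy N ys zs -> word_htpy N xs zs.
Proof. exact: stably_homotopic_trans. Qed.

(** [move_point] for words: the point proj (y a) is moved to proj (y c). *)
Lemma word_htpy_move N l a b c d r (y := wprod l) :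
  local_word (l ++ a :: b :: r) -> local_word (l ++ c :: d :: r) ->
  proj (y * a * b)%g = proj (y * c * d)%g ->
  local_frame EUm [set proj y; proj (y * a)%g; proj (y * c)%g] ->
  local_frame EUm [set proj (y * a)%g; proj (y * c)%g; proj (y * a * b)%g] ->
  word_htpy N (l ++ a :: b :: r) (l ++ c :: d :: r).
Proof.
move=> L1 L2 abcd F1 F2.
have at_l a' b' : wlift N (l ++ a' :: b' :: r) (N + (size l)%:Z) = y.
  by rewrite wlift_nat take_size_cat.
have at_a a' b' : wlift N (l ++ a' :: b' :: r) (N + (size l).+1%:Z) = (y * a')%g.
  rewrite wlift_nat take_cat ltnNge leqnSn /= subSnn /= ?take0.
  by rewrite big_cat /= big_seq1.
have at_b a' b' k : wlift N (l ++ a' :: b' :: r) (N + (size l).+2%:Z + k%:Z)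
    = (y * a' * b' * wprod (take k r))%g.
  rewrite -addrA -PoszD wlift_nat take_cat ifN; last by rewrite -leqNgt; lia.
  have -> : ((size l).+2 + k - size l = k.+2)%N by lia.
  by rewrite /= big_cat /= !big_cons !mulgA.
have pl : N + (size l)%:Z = N + (size l).+1%:Z - 1 by lia.
have pr : N + (size l).+2%:Z + 0%N%:Z = N + (size l).+1%:Z + 1 by lia.
apply: (@move_point _ _ _ _ _ e (proj (y * a * b * wprod r)%g) (N + (size l).+1%:Z)).
- by have := word_pathP N L1; rewrite big_cat /= !big_cons !mulgA.
- have := word_pathP N L2; rewrite big_cat /= !big_cons !mulgA.
  by rewrite (proj_mulr _ abcd).
- move=> i ip; rewrite !word_pathE.
  have [iN|[k ik]] := wlift_cases N i; first by rewrite !wlift_start.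
  have [kl|kl] := leqP k (size l).
    by rewrite ik !wlift_nat !takel_cat.
  have -> : i = N + (size l).+2%:Z + (k - (size l).+2)%N%:Z by lia.
  by rewrite !at_b; exact: proj_mulr.
- by rewrite !word_pathE -pl at_l !at_a.
- rewrite !word_pathE -pr !at_a at_b take0 big_nil mulg1; exact: F2.
Qed.

(** All the points involved lie in one orbit of E_al, so the moved point forms
    local frames with its neighbours. *)
Lemma word_htpy_swap N al l a b c d r :
  nilpotent al -> St_loc al a -> St_loc al b -> St_loc al c -> St_loc al d ->
  local_word l -> local_word r -> (a * b = c * d)%g ->
  word_htpy N (l ++ a :: b :: r) (l ++ c :: d :: r).
Proof.
move=> nil La Lb Lc Ld Ll Lr abcd.
have [L1 LM LV] := St_locP R al.
have loc x : St_loc al x -> local x by exists al.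
apply: word_htpy_move.
- by apply: local_cat => //; do 2! (apply: local_cons; [exact: loc|]).
- by apply: local_cat => //; do 2! (apply: local_cons; [exact: loc|]).
- by rewrite -!mulgA abcd.
- exact: lift_frame3 nil La Lc.
- have := @lift_frame3 al (wprod l * a)%g (a^-1 * c)%g b nil (LM _ _ (LV _ La) Lc) Lb.
  by rewrite -(mulgA _ a (a^-1 * c)%g) mulVKg.
Qed.

Lemma word_path_rcons1 N xs : word_path N (rcons xs 1%g) = word_path N xs.
Proof.
apply/funext => i; rewrite !word_pathE; congr proj.
have [iN|[k ->]] := wlift_cases N i; first by rewrite !wlift_start.
rewrite !wlift_nat -cats1 take_cat; case: ltnP => // kxs.
rewrite (take_oversize kxs) big_cat /=; case: (k - size xs)%N => [|j] /=.
  by rewrite big_nil mulg1.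
by rewrite big_seq1 mulg1.
Qed.

(** A pause at the end does not change the path, and [word_htpy_swap] with
    x 1 = 1 x moves a pause to the left of a letter x. *)
Lemma word_htpy_insert1 N l r : local_word l -> local_word r ->
  word_htpy N (l ++ r) (l ++ 1%g :: r).
Proof.
elim: r l => [|x r IH] l Ll Lxr.
  by rewrite cats0 cats1 /word_htpy word_path_rcons1; exact: word_htpy_refl.
have Lx : local x by apply: Lxr; rewrite mem_head.
have Lr : local_word r by move=> z zr; apply: Lxr; rewrite inE zr orbT.
have := IH (rcons l x); rewrite !cat_rcons => {}IH; apply: (word_htpy_trans (IH _ Lr)).
  by rewrite -cats1; apply: local_cat => //; apply: local_cons.
have [al nil Lax] := Lx; have [L1 _ _] := St_locP R al.
by apply: (word_htpy_swap N nil) => //; rewrite mul1g mulg1.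
Qed.

(** From right to left, the last letter x of a word in St_al is merged with the
    product p of the following ones: x :: p becomes 1 :: x p, and the pause 1
    is dropped. *)
Lemma word_htpy_collapse N al l xs r : nilpotent al ->
  (forall x, x \in xs -> St_loc al x) -> local_word l -> local_word r ->
  word_htpy N (l ++ xs ++ r) (l ++ wprod xs :: r).
Proof.
move=> nil; have [L1 LM LV] := St_locP R al.
have loc x : St_loc al x -> local x by exists al.
elim: xs l => [|x xs IH] l Lxs Ll Lr; first by rewrite big_nil; exact: word_htpy_insert1.
have Lx : St_loc al x by apply: Lxs; rewrite mem_head.
have {}Lxs z : z \in xs -> St_loc al z by move=> zr; apply: Lxs; rewrite inE zr orbT.
have Lp : St_loc al (wprod xs).
  by rewrite big_seq_cond; apply: big_ind => // y /andP[/Lxs].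
have := IH (rcons l x); rewrite !cat_rcons => {}IH; apply: (word_htpy_trans (IH _ _ _)) => //.
  by rewrite -cats1; apply: local_cat => //; apply: local_cons; [exact: loc|].
rewrite big_cons; apply: (@word_htpy_trans _ (l ++ 1%g :: (x * wprod xs)%g :: r)).
  apply: (word_htpy_swap N nil) => //; [exact: LM | by rewrite mul1g].
apply: word_htpy_sym; apply: word_htpy_insert1 => //.
by apply: local_cons => //; apply: loc; exact: LM.
Qed.

Definition winv xs := rev [seq x^-1%g | x <- xs].

Lemma winv_cons x xs : winv (x :: xs) = rcons (winv xs) x^-1%g.
Proof. by rewrite /winv map_cons rev_cons. Qed.

Lemma wprod_inv xs : wprod (winv xs) = (wprod xs)^-1%g.
Proof.
elim: xs => [|x xs IH]; first by rewrite /winv !big_nil invg1.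
by rewrite winv_cons -cats1 big_cat big_seq1 big_cons invgM IH.
Qed.

Lemma local_winv xs : local_word xs -> local_word (winv xs).
Proof. by move=> L x; rewrite mem_rev => /mapP[y /L Ly ->]; exact: localV. Qed.

Lemma winvK xs : winv (winv xs) = xs.
Proof. by rewrite /winv map_rev revK -map_comp map_id_in // => x _ /=; rewrite invgK. Qed.

(** Backtracking, from the innermost pair of letters outwards. *)
Lemma word_htpy_cancel N l xs r : local_word l -> local_word xs -> local_word r ->
  word_htpy N (l ++ xs ++ winv xs ++ r) (l ++ r).
Proof.
elim: xs l r => [|x xs IH] l r Ll Lxs Lr; first exact/word_htpy_refl/local_cat.
have Lx : local x by apply: Lxs; rewrite mem_head.
have {}Lxs : local_word xs by move=> z zr; apply: Lxs; rewrite inE zr orbT.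
rewrite winv_cons cat_rcons; have := IH (rcons l x) (x^-1%g :: r).
rewrite !cat_rcons; move=> {}IH; apply: word_htpy_trans (IH _ _ _) _ => //.
- by rewrite -cats1; apply: local_cat => //; apply: local_cons.
- by apply: local_cons => //; exact: localV.
have [al nil Lax] := Lx; have [_ _ LV] := St_locP R al.
apply: (word_htpy_trans (@word_htpy_collapse N al l [:: x; x^-1%g] r nil _ Ll Lr)).
  by move=> z; rewrite !inE => /orP[] /eqP -> //; exact: LV.
by rewrite big_cons big_seq1 mulgV; apply: word_htpy_sym; exact: word_htpy_insert1.
Qed.

Lemma word_htpy_cancelV N l xs r : local_word l -> local_word xs -> local_word r ->
  word_htpy N (l ++ winv xs ++ xs ++ r) (l ++ r).
Proof.
by move=> Ll Lxs Lr; rewrite -[X in _ ++ X ++ r]winvK;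
  apply: word_htpy_cancel => //; exact: local_winv.
Qed.

(** The expression w read as a path: inverses are pushed down to the letters,
    which are single elements of local subgroups. *)
Fixpoint letters (w : st_word R m.+1) : seq St :=
  match w with
  | st_gen i j ij r => [:: stein ij r]
  | st_one => [::]
  | st_mul u v => letters u ++ letters v
  | st_inv u => winv (letters u)
  end.

Local Open Scope quotient_scope.

Lemma wprod_letters (w : st_word R m.+1) : wprod (letters w) = \pi_(St) w.
Proof.
elim: w => [i j ij r||u IHu v IHv|u IHu] /=.
- by rewrite big_seq1.
- by rewrite big_nil.
- by rewrite big_cat IHu IHv; exact: St_mul_pi.
- by rewrite wprod_inv IHu; exact: St_inv_pi.
Qed.

(** The index sets of the Steinberg relations are nilpotent, so that each of the
    relations holds inside one local subgroup. *)
Lemma nilpotent1 (i j : 'I_m.+1) : i != j -> nilpotent [set (i, j)]%SET.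
Proof.
move=> ij; have ji : (j == i) = false by rewrite eq_sym (negPf ij).
by split=> a b => [||c]; rewrite !inE !xpair_eqE => /andP[/eqP -> /eqP ->] //; rewrite ji.
Qed.

Lemma nilpotent2 (i j k l : 'I_m.+1) : i != j -> k != l -> j != k -> i != l ->
  nilpotent [set (i, j); (k, l)]%SET.
Proof.
move=> ij kl jk il; split=> [a b|a b|a b c]; rewrite !inE !xpair_eqE.
- by case/orP=> /andP[/eqP -> /eqP ->].
- by case/orP=> /andP[/eqP -> /eqP ->]; move: ij kl jk il; rewrite -!val_eqE /=; lia.
- by case/orP=> /andP[/eqP -> /eqP ->]; move: ij kl jk il; rewrite -!val_eqE /=; lia.
Qed.

Lemma nilpotent3 (i j l : 'I_m.+1) : i != j -> j != l -> i != l ->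
  nilpotent [set (i, j); (j, l); (i, l)]%SET.
Proof.
move=> ij jl il; split=> [a b|a b|a b c]; rewrite !inE !xpair_eqE.
- by case/orP=> [/orP[]|] /andP[/eqP -> /eqP ->].
- by case/orP=> [/orP[]|] /andP[/eqP -> /eqP ->]; move: ij jl il; rewrite -!val_eqE /=; lia.
- by case/orP=> [/orP[]|] /andP[/eqP -> /eqP ->]; move: ij jl il; rewrite -!val_eqE /=; lia.
Qed.

Lemma word_htpy_local N al l xs ys (r : seq St) : nilpotent al ->
  (forall x, x \in xs -> St_loc al x) -> (forall x, x \in ys -> St_loc al x) ->
  wprod xs = wprod ys -> local_word l -> local_word r ->
  word_htpy N (l ++ xs ++ r) (l ++ ys ++ r).
Proof.
move=> nil Lxs Lys xys Ll Lr.
apply: (word_htpy_trans (word_htpy_collapse N nil Lxs Ll Lr)).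
by rewrite xys; apply/word_htpy_sym/(word_htpy_collapse N nil Lys Ll Lr).
Qed.

Lemma local_letters (w : st_word R m.+1) : local_word (letters w).
Proof.
elim: w => [i j ij r||u IHu v IHv|u IHu] /=.
- move=> x; rewrite inE => /eqP ->; exists [set (i, j)]%SET; first exact: nilpotent1.
  by apply: generated_sub; exists i, j, ij, r; rewrite inE.
- exact: local_nil.
- exact: local_cat.
- exact: local_winv.
Qed.

Lemma stein_loc al (i j : 'I_m.+1) (ij : i != j) (r : R) :
  (i, j) \in al -> St_loc al (stein ij r).
Proof. by move=> ijal; apply: generated_sub; exists i, j, ij, r. Qed.

Lemma word_htpy_comm N al l (r : seq St) (u v w : st_word R m.+1) : nilpotent al ->
  (forall x, x \in letters u -> St_loc al x) ->
  (forall x, x \in letters v -> St_loc al x) ->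
  (forall x, x \in letters w -> St_loc al x) ->
  st_eq (st_comm u v) w -> local_word l -> local_word r ->
  word_htpy N (l ++ letters (st_comm u v) ++ r) (l ++ letters w ++ r).
Proof.
move=> nil Lu Lv Lw uvw Ll Lr; apply: (word_htpy_local N nil) => //; last first.
  by rewrite !wprod_letters; exact/st_eqP.
have [_ _ LV] := St_locP R al.
move=> x; rewrite /= !mem_cat !mem_rev -!orbA.
case/or4P => [/Lu|/Lv|/mapP[y /Lu Ly ->]|/mapP[y /Lv Ly ->]] //; exact: LV.
Qed.

(** Simple connectedness of the covering: every relation of St_n(R) is a
    homotopy.  Group axioms are equalities of words or backtracking, and each
    Steinberg relation collapses in one local subgroup.  The context l, r is
    there for the congruence rules. *)
Lemma word_htpy_st_eq (u v : st_word R m.+1) : st_eq u v ->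
  forall N l r, local_word l -> local_word r ->
  word_htpy N (l ++ letters u ++ r) (l ++ letters v ++ r).
Proof.
have Lw := local_letters.
elim=> {u v} [u|u v _ IH|u v w _ IH1 _ IH2|u u' v v' _ IH1 _ IH2|u v _ IH
  |u v w|u|u|u|u|i j ij r s|i j k l' ij kl r s jk il|i j l' ij jl il r s]
  N l t Ll Lt /=.
- by apply: word_htpy_refl; do !apply: local_cat.
- exact/word_htpy_sym/IH.
- exact: word_htpy_trans (IH1 _ _ _ Ll Lt) (IH2 _ _ _ Ll Lt).
- rewrite -!catA; apply: (@word_htpy_trans _ (l ++ letters u' ++ letters v ++ t)).
    by apply: IH1 => //; apply: local_cat.
  by rewrite !(catA l); apply: IH2 => //; apply: local_cat.
(* u^-1 = u^-1 (v v^-1) = u^-1 (u v^-1) = v^-1, as only u may be replaced by v. *)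
- have Lu := local_winv (Lw u); have Lv := local_winv (Lw v).
  apply: (@word_htpy_trans _
    ((l ++ winv (letters u)) ++ letters v ++ winv (letters v) ++ t)).
    by rewrite catA; apply: word_htpy_sym; apply: word_htpy_cancel => //; apply: local_cat.
  apply: (@word_htpy_trans _
    ((l ++ winv (letters u)) ++ letters u ++ winv (letters v) ++ t)).
    by apply/word_htpy_sym/IH; apply: local_cat.
  by rewrite -catA; apply: word_htpy_cancelV => //; apply: local_cat.
- by rewrite !catA; apply: word_htpy_refl; do !apply: local_cat.
- by apply: word_htpy_refl; do !apply: local_cat.
- by rewrite cats0; apply: word_htpy_refl; do !apply: local_cat.
- by rewrite -catA; apply: word_htpy_cancelV.
- by rewrite -catA; apply: word_htpy_cancel.
- apply: (@word_htpy_local N _ l [:: stein ij r; stein ij s] [:: stein ij (r + s)] t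
    (nilpotent1 ij)) => //.
  + by move=> x; rewrite in_cons mem_seq1 => /orP[] /eqP ->; apply: stein_loc; rewrite inE.
  + by move=> x; rewrite mem_seq1 => /eqP ->; apply: stein_loc; rewrite inE.
  + rewrite big_cons !big_seq1 [LHS]St_mul_pi; apply/st_eqP; exact: st_relD.
- apply: (word_htpy_comm N (u := st_gen ij r) (v := st_gen kl s) (w := st_one _ _)
    (nilpotent2 ij kl jk il)) => //=.
  + by move=> x; rewrite mem_seq1 => /eqP ->; apply: stein_loc; rewrite !inE eqxx.
  + by move=> x; rewrite mem_seq1 => /eqP ->; apply: stein_loc; rewrite !inE eqxx orbT.
  + exact: st_rel1.
- apply: (word_htpy_comm N (u := st_gen ij r) (v := st_gen jl s) (w := st_gen il (r * s))
    (nilpotent3 ij jl il)) => //=.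
  + by move=> x; rewrite mem_seq1 => /eqP ->; apply: stein_loc; rewrite !inE eqxx.
  + by move=> x; rewrite mem_seq1 => /eqP ->; apply: stein_loc; rewrite !inE eqxx !orbT.
  + by move=> x; rewrite mem_seq1 => /eqP ->; apply: stein_loc; rewrite !inE eqxx !orbT.
  + exact: st_relM.
Qed.

Lemma letters_loc al x : St_loc al x ->
  exists2 w, \pi_(St) w = x & forall y, y \in letters w -> St_loc al y.
Proof.
have [L1 LM LV] := St_locP R al.
move: x; apply: smallest_sub => [|_ [i [j [ij [r [ijal ->]]]]]]; last first.
  exists (st_gen ij r) => // y; rewrite inE => /eqP ->; exact: stein_loc.
split=> [|x y [u ux Lu] [v vy Lv]|x [u ux Lu]].
- by exists (st_one _ _).
- exists (st_mul u v); first by rewrite -St_mul_pi ux vy.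
  by move=> z; rewrite mem_cat => /orP[/Lu|/Lv].
- exists (st_inv u); first by rewrite -St_inv_pi ux.
  by move=> z; rewrite mem_rev => /mapP[y /Lu Ly ->]; exact: LV.
Qed.

Lemma word_htpy_letters xs : local_word xs -> exists2 w : st_word R m.+1,
  \pi_(St) w = wprod xs &
  forall N l r, local_word l -> local_word r ->
    word_htpy N (l ++ xs ++ r) (l ++ letters w ++ r).
Proof.
elim: xs => [|x xs IH] Lxs.
  exists (st_one _ _); first by rewrite big_nil.
  by move=> N l r Ll Lr; apply: word_htpy_refl; apply: local_cat.
have [al nil Lx] : local x by apply: Lxs; rewrite mem_head.
have {}Lxs : local_word xs by move=> z zr; apply: Lxs; rewrite inE zr orbT.
have [w wxs whom] := IH Lxs; have [u ux Lu] := letters_loc Lx.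
exists (st_mul u w).
  by rewrite big_cons -St_mul_pi ux wxs.
move=> N l r Ll Lr; rewrite /= -catA.
apply: (@word_htpy_trans _ (l ++ letters u ++ xs ++ r)).
  apply: (@word_htpy_local N al l [:: x] (letters u)) => //.
  - by move=> z; rewrite inE => /eqP ->.
  - by rewrite big_seq1 wprod_letters.
  - exact: local_cat.
rewrite !(catA l); apply: whom => //; apply: local_cat => //; exact: local_letters.
Qed.

Lemma word_htpy_wprod N xs ys : local_word xs -> local_word ys ->
  wprod xs = wprod ys -> word_htpy N xs ys.
Proof.
move=> Lxs Lys xys; have [u ux hu] := word_htpy_letters Lxs.
have [v vy hv] := word_htpy_letters Lys.
have uv : st_eq u v by apply/st_eqP; rewrite ux vy.
have L0 := local_nil.
have := hu N _ _ L0 L0; have := hv N _ _ L0 L0; have := word_htpy_st_eq uv N L0 L0.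
rewrite /= !cats0 => uv' yv xu.
exact: word_htpy_trans xu (word_htpy_trans uv' (word_htpy_sym yv)).
Qed.

Lemma local_wordP x : exists2 xs, local_word xs & wprod xs = x.
Proof.
elim/quotW: x => w; exists (letters w); [exact: local_letters|exact: wprod_letters].
Qed.

(** The row e theta(l), with l the word xs followed by z^-1, is fixed by a b since
    the whole word ends at e.  So the step by b goes back along the step by a,
    even when a and b belong to different local subgroups, and the single point
    between them can be moved onto e theta(l). *)
Lemma word_htpy_conj N xs al be z a b : local_word xs -> Pt (wprod xs) ->
  nilpotent al -> nilpotent be -> St_loc al a -> St_loc be b ->
  Pt (z^-1 * a * b * z)%g ->
  forall ys, local_word ys -> wprod ys = (wprod xs * (z^-1 * a * b * z))%g ->
  word_htpy N xs ys.
Proof.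
move=> Lxs Pxs nila nilb La Lb Pp ys Lys ysE.
have [zs Lzs zsE] := local_wordP z.
have Lz' := local_winv Lzs.
have loc_a : local a by exists al.
have loc_b : local b by exists be.
pose l := xs ++ winv zs.
have Ll : local_word l by apply: local_cat.
have lE : wprod l = (wprod xs * z^-1)%g by rewrite big_cat wprod_inv zsE.
have lab : proj (wprod l * a * b)%g = proj (wprod l).
  have [_ PM _] := Pt_subgroup R m.
  have /PtE := PM _ _ Pxs Pp.
  rewrite lE => p1; move/PtE: Pxs => px.
  apply: (@etrans _ _ (proj (wprod xs * (z^-1 * a * b * z) * z^-1)%g)).
    by rewrite !mulgA mulgK.
  by rewrite [LHS]projM [RHS]projM p1 px.
have step : word_htpy N (l ++ a :: b :: zs) (l ++ 1%g :: 1%g :: zs).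
  apply: word_htpy_move.
  - by apply: local_cat => //; do 2!(apply: local_cons => //).
  - by apply: local_cat => //; do 2!(apply: local_cons => //; first exact: local1).
  - by rewrite !mulg1.
  - have [L1 _ _] := St_locP R al; exact: lift_frame3 nila La L1.
  - rewrite mulg1 lab; have [L1 _ _] := St_locP R al.
    apply: frame_sub (lift_frame3 (wprod l) nila La L1).
      by exists (proj (wprod l)); right.
    by move=> v [[->|->]|->]; [left; right|left; left|left; left].
apply: (@word_htpy_trans _ (l ++ a :: b :: zs)); last first.
  apply: word_htpy_wprod => //.
    by apply: local_cat => //; do 2!(apply: local_cons => //).
  by rewrite ysE big_cat /= !big_cons lE zsE !mulgA.
apply: word_htpy_sym; apply: (word_htpy_trans step).
apply: word_htpy_wprod => //.
  by apply: local_cat => //; do 2!(apply: local_cons => //; first exact: local1).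
by rewrite big_cat /= !big_cons lE zsE !mul1g mulgVK.
Qed.

(** Being a subgroup, the set of the p in Pt that do not change the homotopy
    class, whatever the word they are appended to, contains Pt2 as soon as it
    contains its generators. *)
Lemma word_htpy_lcoset N xs ys : local_word xs -> local_word ys ->
  Pt (wprod xs) -> same_lcoset Pt2 (wprod xs) (wprod ys) -> word_htpy N xs ys.
Proof.
move=> Lxs Lys Pxs; rewrite /same_lcoset => xy.
suff : Pt2 `<=` [set p | forall xs ys, local_word xs -> local_word ys ->
    Pt (wprod xs) -> wprod ys = (wprod xs * p)%g -> word_htpy N xs ys].
  by move=> /(_ _ xy); apply => //; rewrite mulVKg.
have [P1 PM PV] := Pt_subgroup R m.
suff : Pt2 `<=` [set p | Pt p /\ forall xs ys, local_word xs -> local_word ys ->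
    Pt (wprod xs) -> wprod ys = (wprod xs * p)%g -> word_htpy N xs ys].
  by move=> H p /H[].
apply: smallest_sub => [|p [Pp [al [be [z [a [b [[nila nilb] _ La Lb pE]]]]]]]]; last first.
  split=> // us vs Lu Lv Pu; rewrite pE => vE.
  by rewrite pE in Pp; exact: word_htpy_conj nila nilb La Lb Pp vs Lv vE.
split=> [|p q [Pp Hp] [Pq Hq]|p [Pp Hp]].
- by split=> // us vs Lu Lv _; rewrite mulg1 => vu; exact: word_htpy_wprod.
- split; first exact: PM.
  move=> us vs Lu Lv Pu vE; have [ws Lws wsE] := local_wordP (wprod us * p)%g.
  apply: (word_htpy_trans (Hp us ws Lu Lws Pu wsE)).
  by apply: Hq => //; rewrite wsE; [exact: PM|rewrite vE mulgA].
- split; first exact: PV.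
  move=> us vs Lu Lv Pu vE; apply/word_htpy_sym/Hp => //.
    by rewrite vE; apply: PM => //; exact: PV.
  by rewrite vE mulgVK.
Qed.

(** Existence of lifts; N may be any time before the path starts to move. *)
Lemma word_of_path om v w N : is_path EUm om v w ->
  (forall i, (i <= N)%R -> om i = e) ->
  exists2 xs, local_word xs & om = word_path N xs.
Proof.
move=> [omF _ [M omM]] omN.
pose K := absz (Order.max 0 (M - N)).
suff [xs [Lxs sxs xsE]] : exists xs, [/\ local_word xs, size xs = K &
    forall k, (k <= K)%N -> om (N + k%:Z) = proj (wprod (take k xs))].
  exists xs => //; apply/funext => i; rewrite word_pathE.
  have [iN|[k ->]] := wlift_cases N i; first by rewrite wlift_start // omN // proj1.
  rewrite wlift_nat; have [kK|Kk] := leqP k K; first exact: xsE.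
  rewrite take_oversize -?sxs; last by rewrite sxs ltnW.
  rewrite -[xs in RHS]take_size sxs -xsE // !omM //; lia.
elim: K => [|K [xs [Lxs sxs xsE]]].
  exists [::]; split=> // k; rewrite leqn0 => /eqP ->.
  by rewrite take0 big_nil proj1 omN //; lia.
have := omF (N + K%:Z); have -> : N + K%:Z + 1 = N + K.+1%:Z by lia.
rewrite xsE // => F; have [|al nil fr] :=
  frame_lift (y := wprod (take K xs)) F; first by left.
have [a La aE] := fr (om (N + K.+1%:Z)) (or_intror erefl).
exists (rcons xs a); split.
- by rewrite -cats1; apply: local_cat => //; apply: local_cons => //; exists al.
- by rewrite size_rcons sxs.
move=> k; rewrite leq_eqVlt => /orP[/eqP ->|].
  by rewrite aE -sxs take_size take_oversize ?size_rcons // -cats1 big_cat big_seq1.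
rewrite ltnS => kK; rewrite xsE // -cats1 takel_cat //; lia.
Qed.

(** Homotopy invariance of the endpoint of the lift: each row of the homotopy is
    a loop, hence the path of a word, and two consecutive rows bound a strip. *)
Lemma homotopic_lcoset N xs M ys : local_word xs -> local_word ys ->
  Pt (wprod xs) -> Pt (wprod ys) ->
  stably_homotopic EUm (word_path N xs) (word_path M ys) ->
  same_lcoset Pt2 (wprod xs) (wprod ys).
Proof.
move=> Lxs Lys Px Py [H [HF [v [w HP]] [K0 HK0] [K1 HK1]]].
have [ve we] : v = e /\ w = e.
  move/PtE: Px => px; have := word_pathP N Lxs; rewrite px => xP.
  by apply: path_ends (HP K0) _; rewrite (HK0 K0).
rewrite {}ve {}we in HP.
have rowP k : exists L zs, local_word zs /\ H ^~ k = word_path L zs.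
  have [_ [L HL] _] := HP k.
  by have [zs Lzs zsE] := word_of_path (HP k) HL; exists L, zs.
have word_end L zs (Lzs : local_word zs) k : H^~ k = word_path L zs -> Pt (wprod zs).
  move=> Hk; apply/PtE; have := word_pathP L Lzs; rewrite -Hk => zP.
  by have [_ ->] := path_ends zP (HP k).
have row_step k L zs L' zs' : local_word zs -> local_word zs' ->
    H ^~ k = word_path L zs -> H ^~ (k + 1) = word_path L' zs' ->
    same_lcoset Pt2 (wprod zs) (wprod zs').
  move=> Lz Lz' Hk Hk1; apply: same_sheet_lcoset; first exact: word_end Hk.
  (* a time at which both lifts have reached their endpoints *)
  pose i := Order.max (Order.max L L') (Order.max (L + (size zs)%:Z) (L' + (size zs')%:Z)).
  have zi : wlift L zs i = wprod zs by apply: wlift_end; lia.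
  have zi' : wlift L' zs' i = wprod zs' by apply: wlift_end; lia.
  rewrite -zi -zi' -[wlift L zs i]mulg1.
  apply: (@lifts_over_strip R m (wlift L zs) (wlift L' zs') (Order.min L L')).
  - by move=> j jL; rewrite !wlift_start //; lia.
  - by move=> j; exact: wlift_local.
  - by move=> j; exact: wlift_local.
  - move=> j; have hk u : H u k = proj (wlift L zs u) by have := congr1 (@^~ u) Hk.
    have hk1 u : H u (k + 1) = proj (wlift L' zs' u) by have := congr1 (@^~ u) Hk1.
    by rewrite -!hk -!hk1; exact: HF.
  - lia.
  - exact: local1.
  - rewrite mulg1 zi zi'; have /PtE -> := word_end _ _ Lz _ Hk.
    by have /PtE -> := word_end _ _ Lz' _ Hk1.
have [_ _ tr] : equiv_on setT (same_lcoset Pt2) := same_lcoset_equiv _ (Pt2_subgroup R m).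
(* Up to K0 the rows are the path of xs, from K1 on the path of ys. *)
pose K := Order.min K0 K1.
suff main (k : nat) L zs : local_word zs -> H ^~ (K + k%:Z) = word_path L zs ->
    same_lcoset Pt2 (wprod xs) (wprod zs).
  apply: (main `|K1 - K|%N M) => //; apply: HK1; lia.
elim: k L zs => [|k IH] L zs Lzs Hz.
  apply: (row_step (K - 1) N xs L zs) => //; first by apply: HK0; lia.
  by have -> : K - 1 + 1 = K + 0%N%:Z by lia.
have [L' [zs' [Lzs' Hz']]] := rowP (K + k%:Z).
apply: (tr _ (wprod zs')) => //; first exact: IH Hz'.
apply: (row_step _ _ _ L _ Lzs' Lzs Hz').
by have -> : K + k%:Z + 1 = K + k.+1%:Z by lia.
Qed.

End Words.

(** * The fundamental group as Pt / Pt2 *)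

Section Pi1.
Variables (R : pzRingType) (m : nat).
Local Notation St := (St R m.+1).
Local Notation e := (e_row R m).
Local Notation EUm := (@EUm R m).
Local Notation Pt := (@Pt R m).
Local Notation Pt2 := (@Pt2 R m).
Local Notation wprod xs := (\prod_(x <- xs) x)%g.

Lemma stably_homotopic_equiv : equiv_on (loops EUm e) (stably_homotopic EUm).
Proof.
split=> [om omP|om om' _ _|om om' om'' _ _ _].
- exact: stably_homotopic_refl omP.
- exact: stably_homotopic_sym.
- exact: stably_homotopic_trans.
Qed.

Lemma same_lcoset_Pt2_equiv : equiv_on Pt (same_lcoset Pt2).
Proof. exact: same_lcoset_equiv (Pt2_subgroup R m). Qed.

Lemma loop_word om : loops EUm e om ->
  exists N xs, [/\ local_word xs, Pt (wprod xs) & om = word_path N xs].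
Proof.
move=> omP; have [_ [N omN] _] := omP.
have [xs Lxs omE] := word_of_path omP omN; exists N, xs; split=> //; apply/PtE.
rewrite omE in omP; by have [_ ->] := path_ends (word_pathP N Lxs) omP.
Qed.

Lemma word_path_loop N xs : local_word xs -> Pt (wprod xs) ->
  loops EUm e (word_path N xs).
Proof. by move=> Lxs /PtE px; have := word_pathP N Lxs; rewrite px. Qed.

Lemma lcoset_homotopic N xs M ys : local_word xs -> local_word ys ->
  Pt (wprod xs) -> Pt (wprod ys) -> same_lcoset Pt2 (wprod xs) (wprod ys) ->
  stably_homotopic EUm (word_path N xs) (word_path M ys).
Proof.
have [_ symC trC] := same_lcoset_Pt2_equiv.
(* Both words are first replaced by words that start at a common time K. *)
have restart N' zs K : (K <= N')%R -> local_word zs -> Pt (wprod zs) ->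
    exists us, [/\ local_word us, Pt (wprod us), word_path N' zs = word_path K us &
                   same_lcoset Pt2 (wprod zs) (wprod us)].
  move=> KN Lzs Pz; have loop_zs := word_path_loop N' Lzs Pz.
  have [|us Lus usE] := word_of_path (N := K) loop_zs.
    by move=> i iK; rewrite word_pathE wlift_start ?proj1 //; lia.
  have Pu : Pt (wprod us).
    apply/PtE; have := word_pathP K Lus; rewrite -usE => uP.
    by have [] := path_ends uP loop_zs.
  exists us; split=> //; apply: (@homotopic_lcoset _ _ N' _ K) => //.
  by rewrite -usE; exact: stably_homotopic_refl loop_zs.
move=> Lxs Lys Px Py xy; pose K := Order.min N M.
have [|us [Lus Pu -> xu]] := restart N xs K _ Lxs Px; first lia.
have [|vs [Lvs Pv -> yv]] := restart M ys K _ Lys Py; first lia.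
apply: word_htpy_lcoset => //; apply: (trC _ (wprod xs)) => //; first exact: symC.
exact: trC yv.
Qed.

(** Representatives are chosen: f om is the product of a word for the loop om, and
    g y is the loop of a word for y in Pt.  Invariance and its converse make both
    maps compatible with the equivalence relations and inverse to each other. *)
Lemma lifting_bijection :
  exists (lift : pi_1 R m -> Pt_Pt2 R m) (unlift : Pt_Pt2 R m -> pi_1 R m),
    [/\ path_lifting lift, cancel lift unlift & cancel unlift lift].
Proof.
have [f fP] : {f : (int -> 'rV[R]_m.+1) -> St & forall om, loops EUm e om ->
    exists N xs, [/\ local_word xs, Pt (wprod xs), om = word_path N xs & f om = wprod xs]}.
  apply: (choice (P := fun om y => loops EUm e om -> exists N xs,
    [/\ local_word xs, Pt (wprod xs), om = word_path N xs & y = wprod xs])) => om.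
  have [/loop_word[N [xs [Lxs Px omE]]]|nom] := pselect (loops EUm e om).
    by exists (wprod xs) => _; exists N, xs.
  by exists 1%g.
have [g gP] : {g : St -> (int -> 'rV[R]_m.+1) & forall y, Pt y ->
    exists2 xs, local_word xs & g y = word_path 0 xs /\ wprod xs = y}.
  apply: (choice (P := fun y om => Pt y ->
    exists2 xs, local_word xs & om = word_path 0 xs /\ wprod xs = y)) => y.
  by have [xs Lxs xsE] := local_wordP y; exists (word_path 0 xs) => _; exists xs.
have fD om : loops EUm e om -> Pt (f om).
  by move=> /fP[N [xs [_ Px _ ->]]].
have gD y : Pt y -> loops EUm e (g y).
  by move=> Py; have [xs Lxs [-> xsE]] := gP y Py; apply: word_path_loop; rewrite ?xsE.
have fR om om' : loops EUm e om -> loops EUm e om' ->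
    stably_homotopic EUm om om' -> same_lcoset Pt2 (f om) (f om').
  move=> /fP[N [xs [Lxs Px -> ->]]] /fP[M [ys [Lys Py -> ->]]].
  exact: homotopic_lcoset.
have gR y z : Pt y -> Pt z -> same_lcoset Pt2 y z -> stably_homotopic EUm (g y) (g z).
  move=> Py Pz; have [xs Lxs [-> xsE]] := gP y Py; have [ys Lys [-> ysE]] := gP z Pz.
  by move=> yz; apply: lcoset_homotopic => //; rewrite ?xsE ?ysE.
exists (quotient_map stably_homotopic_equiv same_lcoset_Pt2_equiv fD fR).
exists (quotient_map same_lcoset_Pt2_equiv stably_homotopic_equiv gD gR).
have lift_word N xs (loop_xs : loops EUm e (word_path N xs)) : local_word xs ->
    Pt (wprod xs) -> same_lcoset Pt2 (f (word_path N xs)) (wprod xs).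
  move=> Lxs Px; have [M [ys [Lys Py xyE ->]]] := fP _ loop_xs.
  apply: (@homotopic_lcoset _ _ M _ N) => //; rewrite -xyE.
  exact: stably_homotopic_refl loop_xs.
split.
- move=> N xs loop_xs Pxs Lxs; rewrite quotient_map_cls.
  by apply: (cls_eq _ _ same_lcoset_Pt2_equiv); exact: lift_word.
- move=> C; have [om [omP ->]] := quotientP C; rewrite !quotient_map_cls.
  apply: (cls_eq _ _ stably_homotopic_equiv).
  have [N [xs [Lxs Px omE fE]]] := fP om omP.
  have [ys Lys [-> ysE]] := gP _ (fD _ omP).
  rewrite omE; apply: lcoset_homotopic => //; first by rewrite ysE; exact: fD.
  by rewrite ysE fE; have [r _ _] := same_lcoset_Pt2_equiv; exact: r.
- move=> C; have [y [Py ->]] := quotientP C; rewrite !quotient_map_cls.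
  apply: (cls_eq _ _ same_lcoset_Pt2_equiv).
  have [xs Lxs [gE xsE]] := gP y Py; have loop_g := gD _ Py.
  by move: loop_g; rewrite gE -xsE => loop_xs; apply: lift_word; rewrite ?xsE.
Qed.

Lemma lift_base (lift : pi_1 R m -> Pt_Pt2 R m) (P1 : Pt 1%g) :
  path_lifting lift -> lift (base (pi_1 R m)) = cls _ P1.
Proof.
move=> liftP.
have P1' : Pt (wprod [::]) by rewrite big_nil.
have E0 : word_path 0 [::] = (fun=> e) :> (int -> 'rV[R]_m.+1).
  by apply/funext => i; rewrite word_pathE /wlift take_oversize // big_nil proj1.
have loop0 : loops EUm e (word_path 0 [::]).
  by rewrite E0; apply: const_path; exact: EUm_e.
have := liftP 0 [::] loop0 P1' (fun x => ltac:(by [])).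
have -> : cls (stably_homotopic EUm) loop0 = base (pi_1 R m).
  by apply: quotient_inj => om /=; rewrite E0.
by move=> ->; apply: quotient_inj => y /=; rewrite big_nil.
Qed.

End Pi1.

(** * The parabolic subgroup EP *)

Section Parabolic.
Variables (R : pzRingType) (m : nat).
Implicit Types (s : GL R m.+1) (t : GL R m).

Lemma embV t : emb t^-1%g = (emb t)^-1%g.
Proof. exact: morphV (@embM R m) t. Qed.

Lemma emb_P t : P (emb t).
Proof.
rewrite /P /= -rowE; apply/rowP=> j; rewrite !mxE (@split1 m 0).
rewrite unlift_none /= mxE (@split1 m j).
by case: (unliftP 0 j) => [j'|] -> /=; rewrite !mxE.
Qed.

Lemma rd_emb t : rd (emb t) = t.
Proof. by apply: gl_inj; rewrite rd_mx ?block_mxKdr //; exact: emb_P. Qed.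

(** The condition says that s = (1 0; v 1), and the matrices of this form make up
    the local subgroup of the first column. *)
Lemma rd1_EP2 s : P s -> rd s = 1%g -> EP2 s.
Proof.
move=> Ps s1; have sE := P_block Ps; rewrite -rd_mx // s1 gl_mx1 in sE.
have E1 : E_loc [set ij : 'I_m.+1 * 'I_m.+1 | (ij.1 != 0) && (ij.2 == 0)]%SET s.
  suff -> : s = @MkGL R m.+1 (_, _) (lower_subproof (@dlsubmx R 1 m 1 m (gl_mx s))).
    exact: lower_loc.
  exact: gl_inj.
apply: generated_sub; split; first by split=> //; exact: E_loc_sub E1.
exists [set ij | (ij.1 != 0) && (ij.2 == 0)]%SET, finset.set0, 1%g, s, 1%g.
have [G1 _ _] := @E_subgroup R m.+1.
have [L1 _ _] : is_subgroup (@E_loc R m.+1 finset.set0) by exact: generated_subgroup.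
split=> //; last by rewrite invg1 mul1g !mulg1.
split; [exact: al0_nilpotent | exact: nilpotent0].
Qed.

Lemma emb_rd_coset s : P s -> EP2 ((emb (rd s))^-1 * s)%g.
Proof.
have [_ PM PV] := @P_subgroup R m.
move=> Ps; have Pe := PV _ (emb_P (rd s)).
apply: rd1_EP2; first exact: PM.
by rewrite rdM // -embV rd_emb mulVg.
Qed.

Lemma EP2_emb_rdE s : P s -> EP2 (emb (rd s)) <-> EP2 s.
Proof.
move=> Ps; split=> [H|]; last exact: EP2_emb_rd.
have [_ EM _] := @EP2_subgroup R m.
by rewrite -[s](mulVKg (emb (rd s))); apply: EM => //; exact: emb_rd_coset.
Qed.

(** The generators x^-1 a b x of EP2 lift factor by factor, and their lifts are in
    Pt because Pt is the full preimage of EP. *)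
Lemma EP2_theta : @EP2 R m `<=` @theta R m.+1 @` @Pt2 R m.
Proof.
apply: (generated_image (@thetaM R m.+1) (Pt2_subgroup R m)).
move=> s [EPs [al [be [g [a [b [[nila nilb] /E_theta[x _ xE] La Lb sE]]]]]]].
have [a' La' aE] := E_loc_theta La; have [b' Lb' bE] := E_loc_theta Lb.
have thE : theta (x^-1 * a' * b' * x)%g = s.
  by rewrite !thetaM thetaV xE aE bE sE.
exists (x^-1 * a' * b' * x)%g => //; apply: generated_sub; split.
  by rewrite /Pt /= thE.
by exists al, be, x, a', b'.
Qed.

End Parabolic.

(** * Exactness from K_2 to pi_0 *)

Section Exactness.
Variables (R : pzRingType) (m : nat).
Local Notation e := (e_row R m).

Variables (lift : pi_1 R m -> Pt_Pt2 R m) (unlift : Pt_Pt2 R m -> pi_1 R m).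
Hypotheses (liftP : path_lifting lift) (liftK : cancel lift unlift)
  (unliftK : cancel unlift lift).

Let Pt1 : @Pt R m 1%g. Proof. by have [] := Pt_subgroup R m. Qed.

Lemma unlift_base Y (PY : @Pt R m Y) :
  unlift (cls _ PY) = base (pi_1 R m) <-> Pt2 Y.
Proof.
have eqv := same_lcoset_Pt2_equiv R m.
have [_ _ V] := Pt2_subgroup R m.
rewrite -(liftK (base _)) (lift_base Pt1 liftP); split.
  by move=> /(can_inj unliftK) /(cls_inj eqv); rewrite /same_lcoset mulg1 => /V; rewrite invgK.
by move=> PY2; congr unlift; apply: (cls_eq _ _ eqv); rewrite /same_lcoset mulg1; exact: V.
Qed.

Lemma lcoset_base (G : groupType) (H : set G) (sH : is_subgroup H) (x : G) :
  @cls _ setT (same_lcoset H) x I = cls _ (x := 1%g) I <-> H x.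
Proof.
have eqv := same_lcoset_equiv setT sH; have [_ _ V] := sH.
split; first by move=> /(cls_inj eqv); rewrite /same_lcoset mulg1 => /V; rewrite invgK.
by move=> Hx; apply: (cls_eq _ _ eqv); rewrite /same_lcoset mulg1; exact: V.
Qed.

Lemma delta_eta_exact : exact_at (@delta R m) (unlift \o @eta R m).
Proof.
move=> [Y K2Y]; rewrite /= /eta /= unlift_base; split.
  by case=> [[x [K2x P2x]]] [<-].
move=> P2Y; exists (exist _ Y (conj K2Y P2Y)) => /=.
by congr exist; exact: Prop_irrelevance.
Qed.

Lemma mu_base Y (PY : @Pt R m Y) :
  mu (cls _ PY) = base (K1_mod_K12 R m) <-> EP2 (theta Y).
Proof.
rewrite mu_cls; apply: iff_trans; first exact: lcoset_base (@GL_EP2_subgroup R m) _.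
by rewrite /GL_EP2 /=; apply: EP2_emb_rdE; case: PY.
Qed.

Lemma eta_mu_exact : exact_at (unlift \o @eta R m) (@mu R m \o lift).
Proof.
move=> C; rewrite -{1}(liftK C) /=; have [Y [PY ->]] := quotientP (lift C).
have eqv := same_lcoset_Pt2_equiv R m.
rewrite mu_base; split.
  move=> [[K K2K]] /(can_inj unliftK) /(cls_inj eqv) /= /theta_Pt2.
  by rewrite thetaM thetaV K2K invg1 mul1g.
move=> /EP2_theta[p P2p pE].
have K2K : K2 (Y * p^-1)%g by rewrite /K2 /= thetaM thetaV pE mulgV.
exists (exist _ _ K2K); congr unlift; apply: (cls_eq _ _ eqv).
by rewrite /same_lcoset /= invgM invgK mulgVK.
Qed.

Lemma lambda_base t : lambda (@cls _ setT _ t I) = base (K_1 R m.+1) <-> E (emb t).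
Proof. by rewrite lambda_cls; exact: lcoset_base (@E_subgroup R m.+1) _. Qed.

Lemma mu_lambda_exact : exact_at (@mu R m \o lift) (@lambda R m).
Proof.
move=> C; have [t [[] ->]] := quotientP C; rewrite lambda_base.
have eqv := same_lcoset_equiv setT (@GL_EP2_subgroup R m).
have [_ EM EV] := @E_subgroup R m.+1.
split=> [[D]|Et].
  rewrite /=; have [Y [PY ->]] := quotientP (lift D).
  rewrite mu_cls => /(cls_inj eqv) /emb_coset; rewrite /same_lcoset => H.
  have [PthY EthY] := PY.
  have /EP2_sub[_ H2] := emb_rd_coset PthY.
  have Erd : E (emb (rd (theta Y))).
    have -> : emb (rd (theta Y)) = (theta Y * ((emb (rd (theta Y)))^-1 * theta Y)^-1)%g.
      by rewrite invgM invgK mulVKg.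
    by apply: (EM) => //; exact: EV.
  by have := EM _ _ Erd H; rewrite mulVKg.
have [Y _ YE] := E_theta Et.
have PY : Pt Y by rewrite /Pt /= YE; split=> //; exact: emb_P.
exists (unlift (cls _ PY)); rewrite /= unliftK mu_cls.
by rewrite YE rd_emb.
Qed.

Lemma lambda_alpha_exact : exact_at (@lambda R m) (@alpha R m).
Proof.
move=> C; have [s [[] ->]] := quotientP C; rewrite alpha_cls.
have eqE := same_lcoset_equiv setT (@E_subgroup R m.+1).
have eqJ := @joined_equiv R m.+1 (@Um R m.+1).
have [_ EM _] := @E_subgroup R m.+1.
split=> [[D]|].
  have [t [[] ->]] := quotientP D; rewrite lambda_cls => /(cls_inj eqE).
  rewrite /same_lcoset => Ets; apply: (cls_eq _ _ eqJ); apply: joined_sym.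
  have <- : e *m gl_mx ((emb t)^-1 * s)%g = e *m gl_mx s.
    have [_ _ PV] := @P_subgroup R m.
    by rewrite gl_mxM mulmxA (PV _ (emb_P t)).
  exact: Um_joined_mul Ets (Um_e R m).
move=> /(cls_inj eqJ) /joined_sym /joined_E[g Eg sg].
have Psg : P (s * g^-1)%g.
  by rewrite /P /= gl_mxM mulmxA sg -mulmxA -gl_mxM mulgV gl_mx1 mulmx1.
exists (@cls _ setT _ (rd (s * g^-1)%g) I); rewrite lambda_cls.
apply: (cls_eq _ _ eqE); rewrite /same_lcoset.
have /EP2_sub[_ H] := emb_rd_coset Psg.
by have := EM _ _ H Eg; rewrite -!mulgA mulVg mulg1.
Qed.

End Exactness.

(** * Kernels of unimodular rows and stably free modules *)

Section Splitting.
Variables (R : pzRingType) (n : nat).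
Implicit Types (v w : 'rV[R]_n) (Q : lmodType R^c).
Local Notation ker_beta v := (ker_pred (beta_row v : {linear 'cV[R^c]_n -> (R^c)^o})).

Lemma col_sum_delta (x : 'cV[R^c]_n) : x = \sum_j x j 0 *: delta_mx j 0.
Proof.
rewrite [LHS]matrix_sum_delta; apply: eq_bigr => j _.
by rewrite big_ord1 [ord0](ord1 0).
Qed.

Lemma beta_row_delta v j : beta_row v (delta_mx j 0) = v 0 j.
Proof.
rewrite /beta_row (bigD1 j) //= big1 => [|i /negPf ij].
  by rewrite addr0 mxE !eqxx; exact: (@mulr1 R).
by rewrite mxE ij; exact: (@mulr0 R).
Qed.

Lemma beta_row_inj v w : beta_row v =1 beta_row w -> v = w.
Proof. by move=> vw; apply/rowP => j; rewrite -!beta_row_delta vw. Qed.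

(** The coefficients have to be read in R: the row multiplies from the left, while
    the scalars of the right module R^n multiply from the right. *)
Lemma beta_row_of (f : {linear 'cV[R^c]_n -> (R^c)^o}) :
  f =1 @beta_row R n (\row_j (f (delta_mx j 0) : R)).
Proof.
move=> x; rewrite [in LHS](col_sum_delta x) linear_sum; apply: eq_bigr => j _.
by rewrite linearZ /= mxE.
Qed.

Lemma mulc_of (f : {linear 'cV[R^c]_n -> 'cV[R^c]_n}) :
  f =1 mulc (\matrix_(i, j) f (delta_mx j 0) i 0 : 'M[R]_n).
Proof.
move=> x; apply/colP => i; rewrite [in LHS](col_sum_delta x) linear_sum.
rewrite summxE mxE; apply: eq_bigr => j _.
by rewrite linearZ !mxE.
Qed.

Lemma mulc_inj (A B : 'M[R]_n) : mulc A =1 mulc B -> A = B.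
Proof.
move=> AB; apply/matrixP => i j.
have entry (C : 'M[R]_n) : mulc C (delta_mx j 0) i 0 = C i j.
  rewrite mxE (bigD1 j) //= big1 => [|k /negPf kj].
    by rewrite addr0 mxE !eqxx; exact: (@mulr1 R).
  by rewrite mxE kj; exact: (@mulr0 R).
by rewrite -!entry AB.
Qed.

Lemma linear_iso_GL (f g : {linear 'cV[R^c]_n -> 'cV[R^c]_n}) :
  cancel f g -> cancel g f -> exists A : GL R n, f =1 mulc (gl_mx A).
Proof.
move=> fK gK.
pose A : 'M[R]_n := \matrix_(i, j) f (delta_mx j 0) i 0.
pose B : 'M[R]_n := \matrix_(i, j) g (delta_mx j 0) i 0.
have AB : A *m B = 1%:M.
  apply: mulc_inj => x; rewrite /mulc -mulmxA mul1mx.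
  by rewrite -[RHS]gK mulc_of mulc_of.
have BA : B *m A = 1%:M.
  apply: mulc_inj => x; rewrite /mulc -mulmxA mul1mx.
  by rewrite -[RHS]fK mulc_of mulc_of.
have inv : (A *m B == 1%:M) && (B *m A == 1%:M) by rewrite AB BA !eqxx.
by exists (@MkGL R n (A, B) inv) => x; exact: mulc_of.
Qed.

(** Q is a complement of R in R^n such that beta_v is the projection onto R: both
    the statement that v is unimodular with kernel Q and a trivialization of
    Q + R. *)
Definition splits v Q := exists f : {linear (Q * (R^c)^o)%type -> 'cV[R^c]_n},
  bijective f /\ forall x, beta_row v (f x) = x.2.

Lemma splits_iso v Q : splits v Q -> lmod_iso (Q * (R^c)^o)%type 'cV[R^c]_n.
Proof. by case=> f [bij_f _]; exists f. Qed.

Lemma splits_lmod_iso v Q Q' : lmod_iso Q' Q -> splits v Q -> splits v Q'.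
Proof.
move=> /lmod_isoP[h [h' [hK h'K]]] [f [[g fK gK] vf]].
pose F (x : Q' * (R^c)^o) : 'cV[R^c]_n := f (h x.1, x.2).
have linF : linear F.
  by move=> a x y; rewrite /F -linearP; congr (f (_, _)); rewrite /= linearP.
pose hF := GRing.isLinear.Build _ _ _ _ F linF.
exists (HB.pack F hF : {linear _ -> _}); split; last by move=> x; rewrite /= vf.
exists (fun y => (h' (g y).1, (g y).2)) => [[x c]|y] /=.
  by rewrite /F /= fK /= hK.
by rewrite /F /= h'K -surjective_pairing gK.
Qed.

Lemma splits_kerE v Q : splits v Q -> lmod_iso Q (ker_row v).
Proof.
move=> [f [bij_f vf]]; have [g fK gK] := bij_f.
have fker q : f (q, 0) \in ker_beta v by apply: ker_rowI; rewrite vf.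
pose F (q : Q) : ker_row v := Kernel (fker q).
pose G (w : ker_row v) : Q := (g (\val w)).1.
refine (@lmod_iso_of _ Q (ker_row v) F G _ _ _); rewrite /F /G.
- move=> a x y; apply: val_inj => /=; rewrite -linearP; congr (f (_, _)).
  by rewrite /= scaler0 addr0.
- by move=> q /=; rewrite fK.
- move=> w; apply: val_inj => /=; rewrite -[RHS]gK; congr (f _).
  rewrite [RHS]surjective_pairing; congr pair.
  by rewrite -vf gK; rewrite ker_rowP.
Qed.

(** A right inverse u of v splits beta_v: (w, c) is sent to w + u c. *)
Lemma ker_splits v : Um v -> splits v (ker_row v).
Proof.
move=> [u vu].
pose b (c : R^c) : 'cV[R^c]_n := c *: (u : 'cV[R^c]_n).
have beta_b c : beta_row v (b c) = c.
  transitivity (c *: beta_row v u); first exact: linearZ.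
  have -> : beta_row v u = 1 by exact: vu.
  exact: mulr1.
have H (y : 'cV[R^c]_n) : y - b (beta_row v y) \in ker_beta v.
  by apply: ker_rowI; rewrite beta_rowB beta_b subrr.
pose F (x : ker_row v * (R^c)^o) : 'cV[R^c]_n := \val x.1 + b x.2.
pose G y : ker_row v * (R^c)^o := (Kernel (H y), beta_row v y).
have linF : linear F.
  move=> a x y; rewrite /F /= /b scalerDl -scalerA scalerDr.
  by rewrite addrACA.
pose hF := GRing.isLinear.Build _ _ _ _ F linF.
have vF x : beta_row v (F x) = x.2 by rewrite beta_rowD ker_rowP beta_b add0r.
exists (HB.pack F hF : {linear _ -> _}); split=> //.
exists G => [[x c]|y]; last by rewrite /= /F /= subrK.
have /= vxc := vF (x, c).
by rewrite /G /=; congr pair => //; apply: val_inj; rewrite /= vxc addrK.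
Qed.

(** The second projection, read on R^n through the isomorphism, is beta_v for a
    row v, and the image of (0, 1) is a right inverse of v. *)
Lemma iso_splits Q : lmod_iso (Q * (R^c)^o)%type 'cV[R^c]_n ->
  exists2 v, Um v & splits v Q.
Proof.
move=> /lmod_isoP[f [g [fK gK]]].
have lp : linear (fun x => (g x).2) by move=> a x y; rewrite linearP.
pose hp := GRing.isLinear.Build _ _ _ _ _ lp.
pose p : {linear 'cV[R^c]_n -> (R^c)^o} := HB.pack (fun x => (g x).2) hp.
pose v : 'rV[R]_n := \row_j p (delta_mx j 0).
have vf x : beta_row v (f x) = x.2 by rewrite -beta_row_of /= fK.
exists v; last by exists f; split=> //; exists g.
exists (f (0, 1)); exact: (vf (0, 1)).
Qed.

Lemma linear_inverse (M N : lmodType R^c) (f : {linear M -> N}) : bijective f ->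
  exists g : {linear N -> M}, cancel f g /\ cancel g f.
Proof.
move=> [g fK gK].
pose h := GRing.isLinear.Build _ _ _ _ g (can2_linear fK gK).
by exists (HB.pack g h : {linear N -> M}).
Qed.

(** The automorphism of R^n that carries the splitting of w to that of v is
    the multiplication by a matrix A, and beta_v A = beta_w. *)
Lemma splits_GL v w Q : splits v Q -> splits w Q ->
  exists A : GL R n, w = v *m gl_mx A.
Proof.
move=> [f [/linear_inverse[f' [fK f'K]] vf]] [g [/linear_inverse[g' [gK g'K]] wg]].
have [x|x|A AE] := @linear_iso_GL (f \o g') (g \o f').
- by rewrite /= fK g'K.
- by rewrite /= gK f'K.
exists A; apply: beta_row_inj => x.
by rewrite -beta_row_mulc -AE /= vf -wg g'K.
Qed.

End Splitting.

(** * Exactness from pi_0 to K_0 *)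

Section KZero.
Variables (R : pzRingType) (m : nat).
Local Notation e := (e_row R m).

Lemma free_splits : splits e 'cV[R^c]_m.
Proof.
pose F (x : 'cV[R^c]_m * (R^c)^o) : 'cV[R^c]_(1 + m) := col_mx (const_mx x.2) x.1.
have linF : linear F.
  move=> a x y; rewrite /F scale_col_mx add_col_mx; congr col_mx.
  by apply/colP=> i; rewrite !mxE.
pose hF := GRing.isLinear.Build _ _ _ _ F linF.
exists (HB.pack F hF : {linear _ -> 'cV[R^c]_m.+1}); split.
  exists (fun y : 'cV[R^c]_(1 + m) => (dsubmx y, usubmx y 0 0)) => [[x c]|y] /=.
    by rewrite /F /= col_mxKd col_mxKu mxE.
  rewrite /F /= -[RHS]vsubmxK; congr col_mx.
  by apply/colP=> i; rewrite mxE ord1.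
move=> x /=; rewrite beta_rowE /e_row -rowE !mxE.
by rewrite (@split1 m 0) unlift_none /= mxE.
Qed.

(** If ker beta_v is free of rank m, then v and e have the same complement, so
    v = e A for some A in GL_n(R). *)
Lemma alpha_beta_exact : exact_at (@alpha R m) (@beta R m).
Proof.
have eqJ := @joined_equiv R m.+1 (@Um R m.+1).
have eqL := lmod_iso_equiv (stably_free_of_rank m (S := R^c)).
move=> C; have [v [Umv ->]] := quotientP C; rewrite beta_cls; split=> [[D]|].
  have [s [[] ->]] := quotientP D; rewrite alpha_cls => /(cls_inj eqJ) /ker_row_joined iso.
  apply: (cls_eq _ _ eqL); apply: lmod_iso_trans (lmod_iso_sym iso) _.
  apply: lmod_iso_trans (lmod_iso_sym (ker_row_mul _ _)) _.
  exact/lmod_iso_sym/splits_kerE/free_splits.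
move=> /(cls_inj eqL) /lmod_iso_sym iso.
have := splits_lmod_iso iso (ker_splits Umv).
move=> /(splits_GL free_splits)[A vA].
exists (@cls _ setT _ A I); rewrite alpha_cls; apply: (cls_eq _ _ eqJ).
by rewrite -vA; have [r _ _] := eqJ; exact: r.
Qed.

Lemma beta_gamma_exact : exact_at (@beta R m) (@gamma R m).
Proof.
have eqL k := lmod_iso_equiv (stably_free_of_rank k (S := R^c)).
move=> C; have [Q [sfQ ->]] := quotientP C; rewrite gamma_cls; split=> [[D]|].
  have [v [Umv ->]] := quotientP D; rewrite beta_cls => /(cls_inj (eqL _)) iso.
  apply: (cls_eq _ _ (eqL _)).
  apply: lmod_iso_trans (lmod_iso_add (lmod_iso_sym iso)) _.
  exact/splits_iso/ker_splits.
move=> /(cls_inj (eqL _)) /iso_splits[v Umv vQ].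
exists (cls _ Umv); rewrite beta_cls; apply: (cls_eq _ _ (eqL _)).
exact/lmod_iso_sym/splits_kerE.
Qed.

End KZero.

Theorem proposition5p2 (R : pzRingType) (m : nat) (hn : (3 <= m.+1)%N) :
  exists (lift : pi_1 R m -> Pt_Pt2 R m) (unlift : Pt_Pt2 R m -> pi_1 R m),
    [/\ @path_lifting R m lift, cancel lift unlift, cancel unlift lift &
      let delta : K_22 R m -> K_2 R m := @delta R m in
      let eta : K_2 R m -> pi_1 R m := unlift \o @eta R m in
      let mu : pi_1 R m -> K1_mod_K12 R m := @mu R m \o lift in
      let lambda : K1_mod_K12 R m -> K_1 R m.+1 := @lambda R m in
      let alpha : K_1 R m.+1 -> pi_0 R m := @alpha R m in
      let beta : pi_0 R m -> K0s R m := @beta R m in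
      let gamma : K0s R m -> K0s R m.+1 := @gamma R m in
      [/\ pointed_map delta, pointed_map eta, pointed_map mu,
          pointed_map lambda &
          [/\ pointed_map alpha, pointed_map beta &
              pointed_map gamma]] /\
      [/\ exact_at delta eta, exact_at eta mu,
          exact_at mu lambda, exact_at lambda alpha &
          exact_at alpha beta /\ exact_at beta gamma]].
Proof.
have [lift [unlift [liftP liftK unliftK]]] := lifting_bijection R m.
exists lift, unlift; split=> //.
have exact_pointed (A B C : pointedSet) (f : A -> B) (g : B -> C) :
    pointed_map f -> exact_at f g -> pointed_map g.
  by move=> fb fg; apply/fg; exists (base A).
pose exA := delta_eta_exact liftP liftK unliftK.
pose exB := eta_mu_exact liftK unliftK.
pose exC := @mu_lambda_exact R m lift unlift unliftK.
pose exD := @lambda_alpha_exact R m.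
pose exE := @alpha_beta_exact R m.
pose exF := @beta_gamma_exact R m.
have pA : pointed_map (@delta R m).
  rewrite /pointed_map /=; case: (K2_2_1 R m) => K21 _.
  by congr exist; exact: Prop_irrelevance.
have pB := exact_pointed _ _ _ _ _ pA exA.
have pC := exact_pointed _ _ _ _ _ pB exB.
have pD := exact_pointed _ _ _ _ _ pC exC.
have pE := exact_pointed _ _ _ _ _ pD exD.
have pF := exact_pointed _ _ _ _ _ pE exE.
have pG := exact_pointed _ _ _ _ _ pF exF.
by split; split=> //; split.
Qed.
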